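(* Let $(X,d)$ be a compact metric space and $f:X\to X$ a continuous map. Let $\mathbf a=(a_n)_{n\ge1}$ be a sequence of natural numbers (the value $0$ being allowed) that is uniformly behaved in $\mathbb N$ and completely additive. Suppose $f$ is $\mathbf a$-minimally mean attractable ($\mathbf a$-MMA) and minimally uniquely ergodic $\mathbf a$-mean Lyapunov stable ($\mathbf a$-MUEMLS). Then for every continuous function $\phi:X\to\mathbb C$, every minimal subset $K\subseteq X$ and every $x\in\mathrm{Basin}(K)$, $$\lim_{N\to\infty}\frac1N\sum_{n=1}^N\mu^2(n)\,\phi(f^{a_n}x)=\lim_{N\to\infty}\frac1N\sum_{1\le n\le N,\ n\ \text{square-free}}\phi(f^{a_n}x)=\frac{6}{\pi^2}\int_K\phi\,d\nu_K,$$ where $\nu_K$ is the unique $f|_K$-invariant Borel probability measure on $K$.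
   Context: $\mu$ is the Möbius function. $f^0=\mathrm{Id}$. $\mathbf a$ is uniformly behaved in $\mathbb N$ if for every real $0<\theta<1$, $\lim_{N\to\infty}\frac1N\sum_{n=1}^N e^{2\pi i a_n\theta}=0$. $\mathbf a$ is completely additive if $a_{mn}=a_m+a_n$ for all $m,n\ge1$. For a set $E$ of natural numbers, $\overline D_{\mathbf a}(E)=\limsup_{N\to\infty}\frac1N\#\{1\le n\le N: a_n\in E\}$. A continuous self-map $g$ of a compact metric space $(Y,d)$ is $\mathbf a$-mean Lyapunov stable ($\mathbf a$-MLS) if for every $\epsilon>0$ there are $\delta>0$ and a set $E=E_\epsilon$ of natural numbers with $\overline D_{\mathbf a}(E)<\epsilon$ such that for all $x,y\in Y$ with $d(x,y)<\delta$ one has $d(g^{a_n}x,g^{a_n}y)<\epsilon$ for all $n\ge1$ with $a_n\notin E$. A minimal subset is a nonempty closed $K\subseteq X$ with $f(K)\subseteq K$ such that every orbit $\{f^nx\}_{n\ge0}$, $x\in K$, is dense in $K$. $f$ is $\mathbf a$-MUEMLS if for every minimal subset $K$, $f:K\to K$ is uniquely ergodic (has exactly one invariant Borel probability measure) and $\mathbf a$-MLS. A point $x\in X$ is $\mathbf a$-mean attracted to $K$ if for every $\epsilon>0$ there is $z\in K$ with $\limsup_{N\to\infty}\frac1N\sum_{n=1}^N d(f^{a_n}x,f^{a_n}z)<\epsilon$. $\mathrm{Basin}(K)$ is the set of all points $\mathbf a$-mean attracted to $K$. $f$ is $\mathbf a$-MMA if $X=\bigcup_K\mathrm{Basin}(K)$,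 the union being over all minimal subsets $K$. *)

(* Defs.v *)
From HB Require Import structures.
From mathcomp Require Import all_boot all_order all_algebra.
From mathcomp Require Import all_classical all_reals all_analysis.
From mathcomp Require Import complex.

Set Implicit Arguments.
Unset Strict Implicit.
Unset Printing Implicit Defensive.

Import Order.TTheory GRing.Theory Num.Theory.
Import numFieldNormedType.Exports.

Local Open Scope classical_set_scope.
Local Open Scope ring_scope.
Local Open Scope complex_scope.

(* Arithmetic functions are indexed by [nat], but only the indices n >= 1 are
   ever used; [squarefree 0] is false and [mobius 0] is 0. *)

Definition squarefree (n : nat) : bool :=
  (0 < n)%N && all (fun p => ~~ (p ^ 2 %| n)%N) (primes n).

Definition mobius (n : nat) : int :=
  if squarefree n then (-1) ^+ size (primes n) else 0.

Definition completely_additive (a : nat -> nat) : Prop :=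
  forall m n : nat, (0 < m)%N -> (0 < n)%N -> a (m * n)%N = (a m + a n)%N.

Definition cesaro (F : fieldType) (u : nat -> F) (N : nat) : F :=
  N%:R^-1 * \sum_(1 <= n < N.+1) u n.

(* exp (i t), for t real *)
Definition expi (R : realType) (t : R) : R[i] := cos t +i* sin t.

(* R[i]^o is the field R[i] with the topology of its norm. *)
Definition uniformly_behaved (R : realType) (a : nat -> nat) : Prop :=
  forall theta : R, 0 < theta < 1 ->
    (cesaro (fun n => expi (2 * pi * (a n)%:R * theta)) : nat -> R[i]^o)
      @ \oo --> (0 : R[i]^o).

(* Limits superior are taken in the extended reals. *)
Definition upper_density (R : realType) (a : nat -> nat) (E : set nat) :
    \bar R :=
  limn_esup (fun N : nat =>
    (N%:R^-1 * (count (fun n => a n \in E) (iota 1 N))%:R : R)%:E).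

(* The metric of a subset, compatible with its subspace topology. *)
Section subset_metric.
Context {R : realType} {X : metricType R} (K : set X).

Let d (x y : K) : R := mdist (set_val x) (set_val y).

Let d_ge0 x y : 0 <= d x y. Proof. exact: mdist_ge0. Qed.

Let d_positivity x y : d x y = 0 -> x = y.
Proof. by move=> /mdist_positivity; exact: val_inj. Qed.

Let ballE (x : K) e : ball x e = [set y | d x y < e].
Proof.
have -> : ball x e = ball (set_val x) e \o set_val by [].
by rewrite ballEmdist.
Qed.

HB.instance Definition _ :=
  @PseudoMetric_isMetric.Build R (set_type K) d d_ge0 d_positivity ballE.

End subset_metric.

Definition mean_lyapunov_stable (R : realType) (a : nat -> nat)
    (Y : metricType R) (g : Y -> Y) : Prop :=
  forall eps : R, 0 < eps -> exists (delta : R) (E : set nat),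
    [/\ 0 < delta, (upper_density R a E < eps%:E)%E &
        forall x y : Y, mdist x y < delta ->
        forall n : nat, (0 < n)%N -> ~ E (a n) ->
          mdist (iter (a n) g x) (iter (a n) g y) < eps].

Definition borel (Y : ptopologicalType) := g_sigma_algebraType (@open Y).

Definition invariant_measure (R : realType) (Y : ptopologicalType)
    (g : Y -> Y) (mu : probability (borel Y) R) : Prop :=
  forall A : set (borel Y), measurable A -> mu (g @^-1` A) = mu A.

(* Measures are functions on all sets, so they are compared on Borel sets. *)
Definition uniquely_ergodic (R : realType) (Y : ptopologicalType)
    (g : Y -> Y) : Prop :=
  exists mu : probability (borel Y) R, invariant_measure g mu /\
    forall nu : probability (borel Y) R, invariant_measure g nu ->
      forall A : set (borel Y), measurable A -> nu A = mu A.

Definition cintegral (d : measure_display) (T : measurableType d)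
    (R : realType) (mu : {measure set T -> \bar R}) (F : T -> R[i]) : R[i] :=
  (\int[mu]_x complex.Re (F x)) +i* (\int[mu]_x complex.Im (F x)).

Record minimal_subset (X : topologicalType) (f : X -> X) (K : set X) : Prop :=
  MinimalSubset {
    minimal_nonempty : K !=set0 ;
    minimal_closed : closed K ;
    minimal_invariant : set_fun K K f ;
    minimal_dense : forall x, K x ->
      K `<=` closure (range (fun n : nat => iter n f x)) }.

(* A minimal subset K as a space of its own: [set_type K] together with a
   point, which the library's measurable types require. *)
Definition minimal_space (X : topologicalType) (f : X -> X) (K : set X)
  (hK : minimal_subset f K) : Type := K.

Section minimal_space.
Context {R : realType} {X : metricType R} {f : X -> X} {K : set X}.
Variable hK : minimal_subset f K.

HB.instance Definition _ := Metric.copy (minimal_space hK) (set_type K).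

Let minimal_point : minimal_space hK :=
  SigSub (mem_set (svalP (cid (minimal_nonempty hK)))).

HB.instance Definition _ := isPointed.Build (minimal_space hK) minimal_point.

Definition minimal_incl (y : minimal_space hK) : X := @set_val X K y.

(* f|_K : K -> K *)
Definition minimal_restr (x : minimal_space hK) : minimal_space hK :=
  SigSub (mem_set (minimal_invariant hK (set_valP x))).

End minimal_space.

Arguments minimal_restr {R X f K} hK x.
Arguments minimal_incl {R X f K} hK y.

Definition MUEMLS (R : realType) (a : nat -> nat) (X : metricType R)
    (f : X -> X) : Prop :=
  forall (K : set X) (hK : minimal_subset f K),
    uniquely_ergodic R (minimal_restr hK) /\
    mean_lyapunov_stable a (minimal_restr hK).

Definition mean_attracted (R : realType) (a : nat -> nat) (X : metricType R)
    (f : X -> X) (K : set X) (x : X) : Prop :=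
  forall eps : R, 0 < eps -> exists2 z, K z &
    (limn_esup (fun N : nat =>
      (cesaro (fun n => mdist (iter (a n) f x) (iter (a n) f z)) N)%:E)
     < eps%:E)%E.

Definition basin (R : realType) (a : nat -> nat) (X : metricType R)
    (f : X -> X) (K : set X) : set X := [set x | mean_attracted a f K x].

Definition MMA (R : realType) (a : nat -> nat) (X : metricType R)
    (f : X -> X) : Prop :=
  [set: X] = \bigcup_(K in minimal_subset f) basin a f K.

(* Main.v *)
Require Import Defs.
From mathcomp Require Import all_boot all_order all_algebra.
From mathcomp Require Import all_classical all_reals all_analysis.
From mathcomp Require Import measurable_realfun complex ring lra zify.

(** The proof separates dynamics from arithmetic.

    Dynamics. Let phi be a real continuous function on X, c its mean over K for
    the invariant probability nu, and x a point of the basin of K. The averages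
    of the phi (f^(a n) x) converge to c ([orbit_avg_basin]). By mean attraction
    this reduces to points of K. By mean Lyapunov stability the averages, as
    functions on K, are asymptotically equicontinuous
    ([orbit_avg_equicontinuous]), and by minimality balls of K have positive
    measure ([open_measure_gt0]); so it suffices that the averages converge to c
    in mean square for nu ([mean_ergodic_along]).

    The correlations of phi - c along the orbit form a stationary positive
    definite kernel, which is represented by a spectral functional on functions
    of the frequency t in [0, 1] ([herglotz]). The mean square at issue is the
    value of this functional at the squared modulus of the averages of the
    exp (2 pi i (a n) t). Uniform behaviour says that these tend to 0 for
    0 < t < 1, and bounded convergence ([pfun_bounded_convergence]) concludes,
    provided that there is no spectral mass at t = 0. The latter is the mean
    ergodic theorem for nu ([mean_ergodic], from [birkhoff]), which is available
    because a unique invariant probability is ergodic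
    ([unique_invariant_ergodic]).

    The spectral functional is a limit of periodograms along an ultrafilter, so
    it is only finitely additive; bounded convergence holds for it nonetheless,
    by minimizing a quadratic norm over convex combinations and Dini's theorem.

    Arithmetic. Applied to the composites of phi with the iterates of f, the
    dynamical statement says that the averages of the phi (f^(a n + j) x)
    converge to c for every j. Integers divisible by the square of some prime
    p < y are now sieved out, one prime at a time. Since a is completely
    additive, the multiples p^2 m contribute the same averages with a shift of j
    by a (p^2), hence in the limit a fraction p^-2 of what they are taken from,
    so that the limit is c times the product of the 1 - p^-2 over p < y
    ([sifted_average_cvg]). What separates the sieved integers from the
    square-free ones has density at most 1 / (y - 1), and the products tend to
    6 / pi^2 ([euler_product_cvg]), by the same sieve applied to the sum of the
    inverse squares; the sum over odd integers is computed from the values of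
    1 / sin^2 at dyadic fractions of pi ([sum_odd_squares]). *)

Set Implicit Arguments.
Unset Strict Implicit.
Unset Printing Implicit Defensive.

Import Order.TTheory GRing.Theory Num.Theory.
Import numFieldNormedType.Exports.

Local Open Scope classical_set_scope.
Local Open Scope ring_scope.
Local Open Scope complex_scope.

(** * Bounded convergence for positive functionals *)

Lemma cvg_invn (R : realType) : (fun n => n%:R^-1 : R) @ \oo --> (0 : R).
Proof. by rewrite -cvg_shiftS; exact: cvg_harmonic. Qed.

Lemma cvg_sumr (R : realType) (T : Type) (F : set_system T) (I : Type)
    (s : seq I) (u : I -> T -> R) (l : I -> R) : Filter F ->
  (forall i, u i x @[x --> F] --> l i) ->
  \sum_(i <- s) u i x @[x --> F] --> \sum_(i <- s) l i.
Proof.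
move=> FF ul; elim: s => [|i s IHs].
  by rewrite big_nil; under eq_cvg do rewrite big_nil; exact: cvg_cst.
by rewrite big_cons; under eq_cvg do rewrite big_cons; exact: cvgD.
Qed.

Section bounded_convergence.
Context {R : realType} {T : topologicalType} (K : set T).

Definition bounded_on (h : T -> R) : Prop :=
  exists B, forall t, K t -> `|h t| <= B.

(** Only bounded functions are constrained: the functionals considered below
    are generalized limits, which have no meaningful value on unbounded
    functions. *)
Record positive_functional (L : (T -> R) -> R) : Prop := PositiveFunctional {
  pfunD : forall h k, bounded_on h -> bounded_on k ->
    L (fun t => h t + k t) = L h + L k ;
  pfunZ : forall c h, bounded_on h -> L (fun t => c * h t) = c * L h ;
  pfun_le : forall h k, bounded_on h -> bounded_on k ->
    (forall t, K t -> h t <= k t) -> L h <= L k }.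

Lemma bounded_on_cst (c : R) : bounded_on (fun=> c).
Proof. by exists `|c|. Qed.

Lemma bounded_on_add h k : bounded_on h -> bounded_on k ->
  bounded_on (fun t => h t + k t).
Proof.
move=> [B hB] [B' kB]; exists (B + B') => t Kt.
by rewrite (le_trans (ler_normD _ _))// lerD ?hB ?kB.
Qed.

Lemma bounded_on_mul h k : bounded_on h -> bounded_on k ->
  bounded_on (fun t => h t * k t).
Proof.
move=> [B hB] [B' kB]; exists (B * B') => t Kt.
by rewrite normrM ler_pM ?hB ?kB.
Qed.

Lemma bounded_on_norm h : bounded_on h -> bounded_on (fun t => `|h t|).
Proof. by move=> [B hB]; exists B => t Kt; rewrite normr_id hB. Qed.

Lemma bounded_on_sum (I : Type) (s : seq I) (h : I -> T -> R) :
  (forall i, bounded_on (h i)) -> bounded_on (fun t => \sum_(i <- s) h i t).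
Proof.
move=> hb; elim: s => [|i s IHs].
  by exists 0 => t _; rewrite big_nil normr0.
have [B hB] := bounded_on_add (hb i) IHs.
by exists B => t Kt; rewrite big_cons hB.
Qed.

Lemma bounded_on_sub h k : bounded_on h -> bounded_on k ->
  bounded_on (fun t => h t - k t).
Proof.
move=> [B hB] [B' kB]; exists (B + B') => t Kt.
by rewrite (le_trans (ler_normB _ _))// lerD ?hB ?kB.
Qed.

Lemma pfun_sum (L : (T -> R) -> R) (I : Type) (s : seq I) (h : I -> T -> R) :
  positive_functional L -> (forall i, bounded_on (h i)) ->
  L (fun t => \sum_(i <- s) h i t) = \sum_(i <- s) L (h i).
Proof.
move=> Lp hb; elim: s => [|i s IHs].
  rewrite big_nil -[RHS](mul0r (L (fun=> 0))) -(pfunZ Lp)//.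
    by congr L; apply/funext => t; rewrite big_nil mul0r.
  exact: bounded_on_cst.
rewrite big_cons -IHs -(pfunD Lp)//; last exact: bounded_on_sum.
by congr L; apply/funext => t; rewrite big_cons.
Qed.

Lemma pfun_ge0 (L : (T -> R) -> R) (h : T -> R) :
  positive_functional L -> bounded_on h -> (forall t, K t -> 0 <= h t) ->
  0 <= L h.
Proof.
move=> Lp hb h0; have b0 := bounded_on_cst 0.
rewrite -(mul0r (L (fun=> 0))) -(pfunZ Lp)//; apply: (pfun_le Lp) => //.
  exact: bounded_on_mul.
by move=> t Kt; rewrite mul0r h0.
Qed.

(** The elementary inequality 2 |x| <= x ^+ 2 / e + e, integrated. It plays the
    role of the Cauchy-Schwarz inequality, e being chosen by the user. *)
Lemma pfun_norm_le (L : (T -> R) -> R) (h : T -> R) (e : R) :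
  positive_functional L -> bounded_on h -> 0 < e ->
  L (fun t => `|h t|) <= (e^-1 * L (fun t => h t ^+ 2) + e * L (fun=> 1)) / 2.
Proof.
move=> Lp hb e0.
have hb2 : bounded_on (fun t => h t ^+ 2) by exact: bounded_on_mul.
have b1 := bounded_on_cst 1.
have eb : bounded_on (fun t => e^-1 * h t ^+ 2).
  by apply: bounded_on_mul => //; exact: bounded_on_cst.
have eb1 : bounded_on (fun t => e * 1).
  by apply: bounded_on_mul => //; exact: bounded_on_cst.
rewrite -(pfunZ Lp)// -(pfunZ Lp)// -(pfunD Lp)// mulrC -(pfunZ Lp); last first.
  exact: bounded_on_add.
apply: (pfun_le Lp).
- exact: bounded_on_norm.
- apply: bounded_on_mul; first exact: bounded_on_cst.
  exact: bounded_on_add.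
- move=> t _; rewrite -(real_normK (num_real (h t))).
  set x := `|h t|; rewrite mulr1 -subr_ge0.
  have -> : 2^-1 * (e^-1 * x ^+ 2 + e) - x = 2^-1 * e^-1 * (x - e) ^+ 2.
    by field; rewrite gt_eqF.
  by rewrite mulr_ge0 ?sqr_ge0// mulr_ge0 ?invr_ge0// ltW.
Qed.

Section convex_tails.
Variables (L : (T -> R) -> R) (g : nat -> T -> R) (c : R).
Hypotheses (Lp : positive_functional L) (cK : compact K).
Hypothesis g_cont : forall n, continuous (g n).
Hypothesis g01 : forall n t, K t -> 0 <= g n t <= 1.
Hypothesis g_cvg : forall t, K t -> g ^~ t @ \oo --> (0 : R).

(** The functions g m with n <= m and L (g m) >= c, closed under midpoints. All
    of them satisfy L h >= c, while they are uniformly small at each point for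
    large n, just as the g m are. Convexity is what allows the quadratic norm
    to be minimized, which yields a sequence that converges fast for L. *)
Inductive tail_hull (n : nat) : (T -> R) -> Prop :=
| tail_hull_base m : (n <= m)%N -> c <= L (g m) -> tail_hull n (g m)
| tail_hull_mid h k : tail_hull n h -> tail_hull n k ->
    tail_hull n (fun t => 2^-1 * (h t + k t)).

Hypothesis g_often : forall n, exists2 m, (n <= m)%N & c <= L (g m).

Lemma tail_hull_cont n h : tail_hull n h -> continuous h.
Proof.
elim=> [m _ _|h1 h2 _ c1 _ c2]; first exact: g_cont.
move=> t; apply: cvgM; first exact: cvg_cst.
by apply: cvgD; [exact: c1|exact: c2].
Qed.

Lemma tail_hull01 n h : tail_hull n h -> forall t, K t -> 0 <= h t <= 1.
Proof.
elim=> [m _ _|h1 h2 _ c1 _ c2] t Kt; first exact: g01.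
by have := c1 t Kt; have := c2 t Kt; lra.
Qed.

Lemma tail_hull_bounded n h : tail_hull n h -> bounded_on h.
Proof.
by move=> nh; exists 1 => t Kt; have /andP[h0 h1] := tail_hull01 nh Kt;
  rewrite ger0_norm.
Qed.

Lemma tail_hull_ge n h : tail_hull n h -> c <= L h.
Proof.
elim=> [//|h1 h2 t1 c1 t2 c2].
have b1 := tail_hull_bounded t1; have b2 := tail_hull_bounded t2.
rewrite (pfunZ Lp) ?(pfunD Lp)//; last exact: bounded_on_add.
lra.
Qed.

Lemma tail_hull_mono n m h : (n <= m)%N -> tail_hull m h -> tail_hull n h.
Proof.
move=> nm; elim=> [k mk ck|h1 h2 _ c1 _ c2]; last exact: tail_hull_mid.
by apply: tail_hull_base => //; exact: leq_trans mk.
Qed.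

Lemma tail_hull_small t e : K t -> 0 < e ->
  exists n, forall m h, (n <= m)%N -> tail_hull m h -> h t <= e.
Proof.
move=> Kt e0; have /cvgr0Pnorm_le/(_ _ e0)[n _ ng] := g_cvg Kt.
exists n => m h nm; elim=> [k mk _|h1 h2 _ c1 _ c2]; last by lra.
by apply: le_trans (ng k _); [exact: ler_norm|exact: leq_trans mk].
Qed.

Let energy (h : T -> R) : R := L (fun t => h t ^+ 2).
Let mass : R := L (fun=> 1).
Let emin (n : nat) : R := inf [set energy h | h in tail_hull n].

Let mass_ge0 : 0 <= mass.
Proof. by apply: (pfun_ge0 Lp) => //; exact: bounded_on_cst. Qed.

Let energy_bounded n h : tail_hull n h -> 0 <= energy h <= mass.
Proof.
move=> nh; have hb := tail_hull_bounded nh.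
have hb2 : bounded_on (fun t => h t ^+ 2) by exact: bounded_on_mul.
apply/andP; split.
  by apply: (pfun_ge0 Lp) => // t _; rewrite sqr_ge0.
apply: (pfun_le Lp) => //; first exact: bounded_on_cst.
move=> t Kt; have /andP[h0 h1] := tail_hull01 nh Kt.
by rewrite expr_le1.
Qed.

Let energies_inf n : has_inf [set energy h | h in tail_hull n].
Proof.
split; last first.
  by exists 0 => _ [h nh <-]; have /andP[] := energy_bounded nh.
have [m nm cm] := g_often n.
by exists (energy (g m)), (g m) => //; exact: tail_hull_base.
Qed.

Let emin_le n h : tail_hull n h -> emin n <= energy h.
Proof. by move=> nh; apply: ge_inf; [exact: (energies_inf n).2|exists h]. Qed.

Let emin_mono n m : (n <= m)%N -> emin n <= emin m.
Proof.
move=> nm; apply: lb_le_inf; first exact: (energies_inf m).1.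
by move=> _ [h mh <-]; exact: emin_le (tail_hull_mono nm mh).
Qed.

Let emax : R := sup (range emin).

Let emins_sup : has_sup (range emin).
Proof.
split; first by exists (emin 0%N), 0%N.
exists mass => _ [n _ <-]; have [_ [h nh _]] := (energies_inf n).1.
by apply: le_trans (emin_le nh) _; have /andP[] := energy_bounded nh.
Qed.

(** The midpoint of h and k belongs to the hull, so it cannot have an energy
    much below theirs; by the parallelogram identity h and k are then close. *)
Let parallelogram n h k e : tail_hull n h -> tail_hull n k ->
  energy h <= emin n + e -> energy k <= emin n + e ->
  L (fun t => (h t - k t) ^+ 2) <= 4 * e.
Proof.
move=> nh nk he ke; have mid := emin_le (tail_hull_mid nh nk).
have hb := tail_hull_bounded nh; have kb := tail_hull_bounded nk.
have h2b : bounded_on (fun t => h t ^+ 2) by exact: bounded_on_mul.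
have k2b : bounded_on (fun t => k t ^+ 2) by exact: bounded_on_mul.
have mb := tail_hull_bounded (tail_hull_mid nh nk).
have m2b : bounded_on (fun t => (2^-1 * (h t + k t)) ^+ 2).
  exact: bounded_on_mul.
have bz a u : bounded_on u -> bounded_on (fun t => a * u t).
  by move=> ub; apply: bounded_on_mul => //; exact: bounded_on_cst.
have -> : L (fun t => (h t - k t) ^+ 2) =
    2 * energy h + 2 * energy k + (-4) * energy (fun t => 2^-1 * (h t + k t)).
  rewrite -!(pfunZ Lp)// -!(pfunD Lp)//; try exact: bz.
    by congr L; apply/funext => t; field.
  by apply: bounded_on_add; exact: bz.
lra.
Qed.

(** The minimal energies of the hulls increase with n and are bounded. Take h k
    in a hull whose minimal energy is within 4 ^- k of their supremum, and with
    energy within 4 ^- k of that minimum; then the parallelogram identity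
    applies to consecutive functions, and taking e = 2 ^- k in the inequality
    between L |h| and L (h ^+ 2) gives the stated rate. *)
Lemma tail_hull_fast_cauchy : exists h : nat -> T -> R,
  (forall k, tail_hull k (h k)) /\
  (forall k, L (fun t => `|h k t - h k.+1 t|) <= (8 + mass) / 2 ^+ k).
Proof.
have e4 k : 0 < (4 ^+ k)^-1 :> R by rewrite invr_gt0 exprn_gt0.
have /choice[n0 n0P] k : exists n, emax - (4 ^+ k)^-1 < emin n.
  have [_ [n _ <-] en] := sup_adherent (e4 k) emins_sup.
  by exists n.
(* Increasing, above the identity and above all the thresholds n0 k. *)
pose n k := (k + \sum_(i < k.+1) n0 i)%N.
have nle k : (k <= n k)%N by rewrite leq_addr.
have nS k : (n k <= n k.+1)%N.
  by apply: leq_add => //; rewrite [leqRHS]big_ord_recr leq_addr.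
have nP k : emax - (4 ^+ k)^-1 < emin (n k).
  apply: lt_le_trans (n0P k) _; apply: emin_mono.
  by rewrite /n big_ord_recr/= addnA leq_addl.
have emax_ge k : emin k <= emax.
  by apply: ub_le_sup; [exact: emins_sup.2|exists k].
have /choice[h hP] k : exists h, tail_hull (n k) h /\
    energy h < emin (n k) + (4 ^+ k)^-1.
  have [_ [h nh <-] eh] := inf_adherent (e4 k) (energies_inf (n k)).
  by exists h.
exists h; split=> k; first by apply: tail_hull_mono (hP k).1; exact: nle.
have h1 := tail_hull_mono (nS k) (hP k.+1).1.
have [h0 h0e] := hP k; have [_ h1e] := hP k.+1.
have e4S : (4 ^+ k.+1)^-1 <= (4 ^+ k)^-1 :> R.
  by rewrite lef_pV2 ?posrE ?exprn_gt0// ler_eXn2l// ltr1n.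
have L2 : L (fun t => (h k t - h k.+1 t) ^+ 2) <= 4 * (2 * (4 ^+ k)^-1).
  apply: (parallelogram h0 h1); first by have := e4 k; lra.
  have := emax_ge (n k.+1); have := nP k; lra.
have hb := bounded_on_sub (tail_hull_bounded h0) (tail_hull_bounded h1).
have e2 : 0 < (2 ^+ k)^-1 :> R by rewrite invr_gt0 exprn_gt0.
apply: le_trans (pfun_norm_le Lp hb e2) _.
have E4 : (4 ^+ k)^-1 = (2 ^+ k)^-1 * (2 ^+ k)^-1 :> R.
  by rewrite -invfM -exprMn; congr (_ ^+ _)^-1; lra.
rewrite invrK.
have : 2 ^+ k * L (fun t => (h k t - h k.+1 t) ^+ 2) <= 8 * (2 ^+ k)^-1.
  rewrite mulrC -ler_pdivlMr ?exprn_gt0//.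
  by apply: le_trans L2 _; rewrite E4; lra.
rewrite -/mass; have := mass_ge0; move: e2.
set x := _^-1; set y := L _ => x0 m0 yx.
rewrite [X in (X + _) / 2](_ : _ = 2 ^+ k * y)//.
have : 0 <= x * mass by rewrite mulr_ge0// ltW.
lra.
Qed.

(** Since h m tends to 0 pointwise, h n is at most the sum of the series of the
    |h k - h k.+1|, k >= n, at every point. As h n and the partial sums are
    continuous and the latter increase, Dini's argument on the compact K gives
    h n <= e + a partial sum, uniformly. Positivity and the fast convergence
    then bound c <= L (h n) by a constant times e + 2 ^- n. *)
Lemma tail_hull_le0 : c <= 0.
Proof.
have [h [hh hL]] := tail_hull_fast_cauchy.
pose F n m t := \sum_(n <= k < m) `|h k t - h k.+1 t|.
have hF n m t : (n <= m)%N -> h n t <= h m t + F n m t.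
  move=> nm; rewrite -lerBlDl -opprB -(telescope_sumr (fun k => h k t) nm).
  rewrite (le_trans (ler_norm _))// normrN (le_trans (ler_norm_sum _ _ _))//.
  by apply: ler_sum => k _; rewrite distrC.
have Fcont n m : continuous (F n m).
  by move=> t; rewrite /F; apply: cvg_sumr => k; apply: cvg_norm;
  by apply: cvgB; [exact: (tail_hull_cont (hh k))|exact: (tail_hull_cont (hh k.+1))].
have Fmono n m m' t : (m <= m')%N -> F n m t <= F n m' t.
  move=> mm'; rewrite /F; have [nm|mn] := leqP n m.
    by rewrite (big_cat_nat nm mm')/= lerDl sumr_ge0.
  by rewrite big_geq ?sumr_ge0// ltnW.
have dini n e : 0 < e -> exists2 m, (n <= m)%N & forall t, K t -> h n t <= e + F n m t.
  move=> e0.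
  have /compact_near_coveringP/(_ _ \oo (fun m t => h n t < e + F n m t)) := cK.
  case=> [t Kt|N _ NP]; last first.
    exists (maxn n N) => [|t Kt]; first exact: leq_maxl.
    by apply/ltW/NP => //; exact: leq_maxr.
  have e2 : 0 < e / 2 by rewrite divr_gt0.
  have [n1 n1P] := tail_hull_small Kt e2.
  pose m := maxn n n1.
  have tm : h n t < e + F n m t.
    rewrite (le_lt_trans (hF n m t (leq_maxl _ _)))// ltrD2r.
    by rewrite (le_lt_trans (n1P m _ (leq_maxr _ _) (hh m)))//; lra.
  have cont : {for t, continuous (fun s => e + F n m s - h n s)}.
    apply: cvgB; last exact: (tail_hull_cont (hh n)).
    by apply: cvgD; [exact: cvg_cst|exact: Fcont].
  have := cont; move/cvgr_gt => /(_ 0); rewrite subr_gt0 => /(_ tm) V.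
  near=> s i; rewrite /=.
  have smn : h n s < e + F n m s.
    by rewrite -subr_gt0; near: s.
  apply: lt_le_trans smn _; rewrite lerD2l Fmono//.
  by near: i; exists m.
have hb k : bounded_on (fun t => `|h k t - h k.+1 t|).
  apply: bounded_on_norm; apply: bounded_on_sub.
    exact: tail_hull_bounded (hh k).
  exact: tail_hull_bounded (hh k.+1).
have geo n m : (n <= m)%N -> \sum_(n <= k < m) (2 ^+ k)^-1 <= 2 / 2 ^+ n :> R.
  move=> nm; suff : \sum_(n <= k < m) (2 ^+ k)^-1 = 2 / 2 ^+ n - 2 / 2 ^+ m :> R.
    by move=> ->; rewrite gerBl divr_ge0// exprn_ge0.
  rewrite -opprB -(telescope_sumr (fun k => 2 / 2 ^+ k) nm) -sumrN.
  apply: eq_bigr => k _; rewrite exprS; field.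
  by rewrite expf_neq0.
have cle n e : 0 < e -> c <= e * mass + (8 + mass) * (2 / 2 ^+ n).
  move=> e0; have [m nm hnm] := dini n e e0.
  have b1 : bounded_on (fun=> e * 1) by exact: bounded_on_cst.
  have Fb : bounded_on (F n m) by exact: bounded_on_sum.
  apply: le_trans (tail_hull_ge (hh n)) _.
  apply: (@le_trans _ _ (L (fun t => e * 1 + F n m t))).
    apply: (pfun_le Lp); [exact: tail_hull_bounded (hh n)|exact: bounded_on_add|].
    by move=> t Kt; rewrite mulr1 hnm.
  rewrite (pfunD Lp)// (pfunZ Lp); last exact: bounded_on_cst.
  rewrite lerD2l /F pfun_sum//.
  apply: (@le_trans _ _ (\sum_(n <= k < m) (8 + mass) / 2 ^+ k)).
    by apply: ler_sum => k _.
  by rewrite -mulr_sumr ler_wpM2l ?geo// addr_ge0.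
rewrite leNgt; apply/negP => c0.
have M0 : 0 < 8 + mass by rewrite ltr_pwDl.
(* With e and 2 ^- n at most this constant the bound of c is below c. *)
have cm : 0 < c / (4 * (8 + mass)) by rewrite divr_gt0// mulr_gt0.
have half01 : `|2^-1 : R| < 1 by rewrite ger0_norm; lra.
have /cvgr0Pnorm_lt/(_ _ cm)[n _ /(_ n (leqnn n))] := cvg_expr half01.
rewrite /= ger0_norm ?exprn_ge0// exprVn => nc.
have := cle n _ cm; apply/negP; rewrite -ltNge.
rewrite [ltRHS](_ : c = c / (4 * (8 + mass)) * (8 + mass) +
    (8 + mass) * (c / (4 * (8 + mass)) * 3)); last by field; rewrite gt_eqF.
apply: ler_ltD; first by rewrite ler_pM2l//; lra.
rewrite ltr_pM2l//; lra.
Unshelve. all: by end_near. Qed.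

End convex_tails.

(** Bounded convergence for a functional that is merely finitely additive. If
    its values at the g n stayed above e infinitely often, then the hulls of
    the tails would force e <= 0. *)
Theorem pfun_bounded_convergence (L : (T -> R) -> R) (g : nat -> T -> R) :
  positive_functional L -> compact K -> (forall n, continuous (g n)) ->
  (forall n t, K t -> 0 <= g n t <= 1) ->
  (forall t, K t -> g ^~ t @ \oo --> (0 : R)) ->
  L \o g @ \oo --> (0 : R).
Proof.
move=> Lp cK gc g01 gt; apply/cvgr0Pnorm_lt => e e0.
have gb n : bounded_on (g n).
  by exists 1 => t Kt; have /andP[h0 h1] := g01 n t Kt; rewrite ger0_norm.
have Lg0 n : 0 <= L (g n).
  by apply: (pfun_ge0 Lp) => // t Kt; have /andP[] := g01 n t Kt.
apply: contrapT => nev.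
have often n : exists2 m, (n <= m)%N & e <= L (g m).
  apply: contrapT => no; apply: nev; exists n => // m /= nm.
  by rewrite ger0_norm// ltNge; apply/negP => em; apply: no; exists m.
by have := tail_hull_le0 Lp cK gc g01 gt often; rewrite leNgt e0.
Qed.

End bounded_convergence.

(** * The spectral functional of a stationary kernel *)

(** 2 sin (x / 2) cos (l x) is the difference of the sines of (l + 1/2) x and
    (l - 1/2) x. *)
Lemma telescope_cos (R : realType) (x : R) (n : nat) :
  2 * sin (x / 2) * \sum_(l < n) cos (l%:R * x) =
  sin (n%:R * x - x / 2) + sin (x / 2).
Proof.
elim: n => [|n IHn].
  by rewrite big_ord0 mulr0 mul0r add0r sinN addNr.
rewrite big_ord_recr/= mulrDr IHn.
have -> : n.+1%:R * x - x / 2 = n%:R * x + x / 2 by rewrite -natr1; lra.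
by rewrite (sinD (n%:R * x) (x / 2)) (sinB (n%:R * x) (x / 2)); ring.
Qed.

Lemma sin_natpi (R : realType) (k : nat) (y : R) :
  sin (k%:R * (2 * pi) - y) = - sin y.
Proof.
rewrite -sinN addrC mulr_natl -(periodicn (@sinD2pi R) k (- y)).
by rewrite [2 * pi]mulr_natl.
Qed.

Lemma sum_cos_root (R : realType) (k n : nat) : (0 < k < n)%N ->
  \sum_(l < n) cos (l%:R * (k%:R * (2 * pi) / n%:R)) = 0 :> R.
Proof.
move=> /andP[k0 kn]; set x := k%:R * _ / _.
have nn := leq_trans k0 (ltnW kn).
have n0 : 0 < n%:R :> R by rewrite ltr0n.
have sx : 0 < sin (x / 2).
  have -> : x / 2 = pi * (k%:R / n%:R) by rewrite /x; field; rewrite gt_eqF.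
  rewrite sin_gt0_pi// mulr_gt0 ?pi_gt0 ?divr_gt0 ?ltr0n//=.
  by rewrite -[ltRHS]mulr1 ltr_pM2l ?pi_gt0// ltr_pdivrMr// mul1r ltr_nat.
have := telescope_cos x n.
have -> : n%:R * x = k%:R * (2 * pi) by rewrite /x; field; rewrite gt_eqF.
rewrite sin_natpi addNr => /eqP; rewrite mulf_eq0 mulf_eq0 pnatr_eq0/=.
by rewrite (gt_eqF sx)/= => /eqP.
Qed.

Definition angle (R : realType) (n : nat) (t : R) : R := 2 * pi * n%:R * t.

Lemma angleD (R : realType) (m n : nat) (t : R) :
  angle (m + n) t = angle m t + angle n t.
Proof. by rewrite /angle natrD mulrDr mulrDl. Qed.

(** Orthogonality of the characters at the n-th roots of unity, for frequencies
    that differ by less than n. *)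
Lemma sum_cos_node (R : realType) (p q n : nat) : (p < q + n)%N -> (q < p + n)%N ->
  \sum_(l < n) cos (angle p (l%:R / n%:R) - angle q (l%:R / n%:R)) =
  n%:R * (p == q)%:R :> R.
Proof.
wlog : p q / (q <= p)%N.
  move=> H pq qp; have [le_qp|/ltnW le_pq] := leqP q p; first exact: H.
  rewrite eq_sym -H//; apply: eq_bigr => l _.
  by rewrite -[LHS]cosN opprB.
move=> qp pqn _; have [->|neq] := eqVneq p q.
  rewrite mulr1; under eq_bigr do rewrite subrr cos0.
  by rewrite sumr_const card_ord.
rewrite mulr0 -[RHS](@sum_cos_root R (p - q) n); last first.
  by rewrite subn_gt0 ltn_neqAle eq_sym neq qp/= ltn_subLR.
apply: eq_bigr => l _; congr cos; rewrite /angle natrB//; field.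
by rewrite pnatr_eq0 -lt0n (leq_ltn_trans _ (ltn_ord l)).
Qed.

Definition bounded_seq (R : realType) (s : nat -> R) : Prop :=
  exists B, forall n, `|s n| <= B.

Lemma ultra_fmap (T V : Type) (U : set_system T) (s : T -> V) :
  UltraFilter U -> UltraFilter (s @ U).
Proof.
move=> UU; split=> [|G GG sUG]; first exact: fmap_proper_filter.
apply/seteqP; split=> // A GA.
have [//|UnA] := in_ultra_setVsetC (s @^-1` A) UU.
have [x [Ax nAx]] := filter_ex (filterI GA (sUG (~` A) UnA)).
by case: nAx.
Qed.

Lemma ultra_cvg (R : realType) (U : set_system nat) (s : nat -> R) :
  UltraFilter U -> bounded_seq s -> s @ U --> lim (s @ U).
Proof.
move=> UU [B sB].
have := @segment_compact R (- B) B; rewrite compact_ultra => cpt.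
have sU : (s @ U) [set` `[- B, B]].
  apply: (@filterS _ U _ setT); last exact: filterT.
  by move=> n _ /=; rewrite in_itv/= -ler_norml.
have [l [_ sl]] := cpt (s @ U) (ultra_fmap s UU) sU.
exact: cvgP sl.
Qed.

Section herglotz.
Context {R : realType} (C : nat -> nat -> R).
Hypothesis C_sym : forall i j, C i j = C j i.
Hypothesis C_shift : forall i j, C i.+1 j.+1 = C i j.
Hypothesis C_pos : forall n (x : nat -> R),
  0 <= \sum_(i < n) \sum_(j < n) x i * x j * C i j.

Let node (M l : nat) : R := l%:R / (2 * M)%:R.

(** The periodogram of the times below M. The 2 M nodes, instead of M, keep the
    differences of two such times from wrapping around. *)
Let weight (M l : nat) : R :=
  (2 * M ^ 2)%:R^-1 * \sum_(i < M) \sum_(j < M)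
    C i j * cos (angle i (node M l) - angle j (node M l)).

Let quadrature (M : nat) (h : R -> R) : R :=
  \sum_(l < 2 * M) weight M l * h (node M l).

(** The formula for cos (x - y) splits the weight into the values of the
    positive definite form at a vector of cosines and at a vector of sines. *)
Let weight_ge0 M l : 0 <= weight M l.
Proof.
rewrite /weight mulr_ge0 ?invr_ge0//.
rewrite [leRHS](_ : _ =
  \sum_(i < M) \sum_(j < M) cos (angle i (node M l)) * cos (angle j (node M l)) * C i j +
  \sum_(i < M) \sum_(j < M) sin (angle i (node M l)) * sin (angle j (node M l)) * C i j).
  apply: addr_ge0; first exact: (C_pos M (fun i => cos (angle i (node M l)))).
  exact: (C_pos M (fun i => sin (angle i (node M l)))).
rewrite -big_split; apply: eq_bigr => i _; rewrite -big_split.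
by apply: eq_bigr => j _; rewrite cosB/=; ring.
Qed.

Let C_shiftn k i j : C (i + k) (j + k) = C i j.
Proof. by elim: k => [|k IHk]; rewrite ?addn0// !addnS C_shift. Qed.

Lemma sum_shifted_pairs (M q : nat) : (q <= M)%N ->
  \sum_(i < M) \sum_(j < M) ((i + q)%N == j)%:R = (M - q)%:R :> R.
Proof.
move=> qM.
transitivity (\sum_(i < M) ((i + q < M)%N : nat)%:R : R).
  apply: eq_bigr => i _; have [iqM|Miq] := ltnP (i + q) M.
    rewrite (bigD1 (Ordinal iqM))//= eqxx big1 ?addr0// => j /eqP jiq.
    by case: eqP => // e; case: jiq; apply/val_inj.
  by rewrite big1// => j _; case: eqP => // e; move: Miq; rewrite e leqNgt ltn_ord.
rewrite -natr_sum; congr _%:R.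
rewrite -(big_mkord xpredT (fun i => (i + q < M)%N : nat)).
rewrite (@big_cat_nat _ _ _ (M - q)%N)//= ?leq_subr//.
rewrite [X in (_ + X)%N]big_nat [X in (_ + X)%N]big1 ?addn0; last first.
  by move=> i /andP[Mi _]; lia.
rewrite big_nat (eq_bigr (fun=> 1%N)) -?big_nat ?sum_nat_const_nat ?subn0 ?muln1//.
by move=> i /andP[_ iM]; have -> : (i + q < M)%N by lia.
Qed.

(** By orthogonality, only the pairs of times at distance q contribute, and
    there are M - q of them on each side of the diagonal. *)
Let quadrature_cos0 M q : (q <= M)%N -> (0 < M)%N ->
  quadrature M (fun t => cos (angle q t - angle 0 t)) = (M - q)%:R / M%:R * C q 0.
Proof.
move=> qM M0; have M0r : M%:R != 0 :> R by rewrite pnatr_eq0 -lt0n.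
pose d i j : R := ((i + q)%N == j)%:R.
transitivity ((2 * M%:R)^-1 * \sum_(i < M) \sum_(j < M) (C q 0 * (d i j + d j i))).
  transitivity ((2 * M ^ 2)%:R^-1 * \sum_(i < M) \sum_(j < M) C i j *
      \sum_(l < 2 * M) (cos (angle i (node M l) - angle j (node M l)) *
                        cos (angle q (node M l) - angle 0 (node M l)))).
    rewrite /quadrature /weight.
    under eq_bigr do rewrite -mulrA mulr_suml.
    rewrite -mulr_sumr exchange_big; congr (_ * _); apply: eq_bigr => i _.
    under eq_bigr do rewrite mulr_suml.
    rewrite exchange_big; apply: eq_bigr => j _; rewrite mulr_sumr.
    by apply: eq_bigr => l _; rewrite mulrA.
  have E i j : (i < M)%N -> (j < M)%N -> C i j *
      \sum_(l < 2 * M) (cos (angle i (node M l) - angle j (node M l)) *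
                        cos (angle q (node M l) - angle 0 (node M l))) =
      M%:R * (C q 0 * (d i j + d j i)).
    move=> iM jM.
    rewrite (eq_bigr (fun l : 'I_(2 * M) => 2^-1 *
        (cos (angle (i + q) (node M l) - angle j (node M l)) +
         cos (angle i (node M l) - angle (j + q) (node M l))))); last first.
      move=> l _; rewrite !angleD {3 4}/angle mulr0 mul0r subr0.
      set x := angle i _; set y := angle j _; set z := angle q _.
      have -> : x + z - y = (x - y) + z by ring.
      have -> : x - (y + z) = (x - y) - z by ring.
      by rewrite [cos (_ + z)]cosD [cos (_ - z)]cosB; field.
    rewrite -mulr_sumr big_split/= !sum_cos_node ?natrM; try lia.
    rewrite /d [(j + q)%N == i]eq_sym.
    have Cq k : C (k + q) k = C q 0.
      by rewrite -(C_shiftn k q 0) add0n addnC.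
    have Cq' k : C k (k + q) = C q 0 by rewrite C_sym.
    have [e|_] := eqVneq (i + q)%N j; have [e'|_] := eqVneq i (j + q)%N.
    + by have -> : C i j = C q 0 by [rewrite -e]; field.
    + by have -> : C i j = C q 0 by [rewrite -e]; field.
    + by have -> : C i j = C q 0 by [rewrite e']; field.
    + by rewrite /= !mulr0 addr0 !mulr0.
  rewrite !mulr_sumr; apply: eq_bigr => i _; rewrite !mulr_sumr; apply: eq_bigr => j _.
  by rewrite E// natrM natrX; field.
under eq_bigr do rewrite -mulr_sumr big_split/= mulrDr.
rewrite big_split/= -!mulr_sumr [X in _ * (_ + _ * X)]exchange_big/=.
by rewrite !sum_shifted_pairs//; field.
Qed.

Let C00_ge0 : 0 <= C 0 0.
Proof. by have := C_pos 1 (fun=> 1); rewrite !big_ord1 !mul1r. Qed.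

Let mass_weight M : \sum_(l < 2 * M) weight M l <= C 0 0.
Proof.
case: M => [|M]; first by rewrite muln0 big_ord0.
have := @quadrature_cos0 M.+1 0 isT isT; rewrite subn0 divff ?pnatr_eq0// mul1r => <-.
by apply: ler_sum => l _; rewrite subrr cos0 mulr1.
Qed.

Let node_in M l : (l < 2 * M)%N -> [set` `[0, 1]] (node M l).
Proof.
move=> lM; have M0 : 0 < (2 * M)%:R :> R by rewrite ltr0n; lia.
by rewrite /= in_itv/= divr_ge0//= ler_pdivrMr// mul1r ler_nat ltnW.
Qed.

Let quadrature_bounded h : @bounded_on R R `[0, 1] h ->
  bounded_seq (fun M => quadrature M h).
Proof.
move=> [B hB]; have B0 : 0 <= B.
  by apply: le_trans (hB 0 _) => //=; rewrite in_itv/= lexx ler01.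
exists (C 0 0 * B) => M; rewrite (le_trans (ler_norm_sum _ _ _))//.
apply: (@le_trans _ _ ((\sum_(l < 2 * M) weight M l) * B)); last first.
  by rewrite ler_wpM2r.
rewrite mulr_suml; apply: ler_sum => l _; rewrite normrM ger0_norm//.
by rewrite ler_wpM2l// hB//; exact: node_in.
Qed.

(** Herglotz's theorem, with a positive functional on functions in the role of
    the spectral measure. It is the limit of the quadratures along an
    ultrafilter finer than the filter at infinity, so that every bounded
    function has a limit; on cosines the quadratures converge in the ordinary
    sense. *)
Theorem herglotz : exists L : (R -> R) -> R,
  @positive_functional R R `[0, 1] L /\
  forall p q, L (fun t => cos (angle p t - angle q t)) = C p q.
Proof.
have [U [UU Uoo]] := @ultraFilterLemma _ \oo _.
pose L h := lim ((fun M => quadrature M h) @ U).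
have Lcvg h : @bounded_on R R `[0, 1] h -> (fun M => quadrature M h) @ U --> L h.
  by move=> hb; apply: ultra_cvg => //; exact: quadrature_bounded.
exists L; split.
  split.
  - move=> h k hb kb; apply: cvg_lim => //.
    rewrite (_ : (fun M => _) = fun M => quadrature M h + quadrature M k).
      by apply: cvgD; exact: Lcvg.
    apply/funext => M; rewrite /quadrature -big_split.
    by apply: eq_bigr => l _; rewrite mulrDr.
  - move=> c h hb; apply: cvg_lim => //.
    rewrite (_ : (fun M => _) = fun M => c * quadrature M h).
      by apply: cvgM; [exact: cvg_cst|exact: Lcvg].
    apply/funext => M; rewrite /quadrature mulr_sumr.
    by apply: eq_bigr => l _; rewrite mulrCA.
  - move=> h k hb kb hk; apply: ler_lim.
    + exact: cvgP (Lcvg _ hb).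
    + exact: cvgP (Lcvg _ kb).
    apply: filterS filterT => M _; apply: ler_sum => l _.
    by rewrite ler_wpM2l// hk//; exact: node_in.
have Lq q : L (fun t => cos (angle q t - angle 0 t)) = C q 0.
  apply: cvg_lim => //; apply: cvg_trans; first exact: cvg_app Uoo.
  apply: (@cvg_trans _ ((fun M => (1 - q%:R * M%:R^-1) * C q 0) @ \oo)).
    apply: near_eq_cvg; near=> M.
    have qM : (q <= M)%N by near: M; exact: nbhs_infty_ge.
    have M0 : (0 < M)%N by near: M; exact: nbhs_infty_gt.
    by rewrite quadrature_cos0// natrB//; field; rewrite pnatr_eq0 -lt0n.
  have : (fun M => (1 - q%:R * M%:R^-1) * C q 0) @ \oo --> (1 - q%:R * 0) * C q 0.
    apply: cvgM; last exact: cvg_cst.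
    apply: cvgB; first exact: cvg_cst.
    by apply: cvgM; [exact: cvg_cst|exact: cvg_invn].
  by rewrite mulr0 subr0 mul1r.
move=> p q; wlog qp : p q / (q <= p)%N.
  move=> H; have [qp|/ltnW pq] := leqP q p; first exact: H.
  rewrite C_sym -H//; congr L; apply/funext => t.
  by rewrite -cosN opprB.
have -> : C p q = C (p - q) 0 by rewrite -(C_shiftn q (p - q) 0) subnK.
rewrite -Lq; congr L; apply/funext => t.
by rewrite -{1}(subnK qp) angleD; congr cos; rewrite /angle; lra.
Unshelve. all: by end_near. Qed.

End herglotz.

(** * Averages of a stationary kernel along a sequence of times *)

Section trig_power.
Context {R : realType}.

(** The squared modulus of N^-1 \sum_(i < N) exp (2 pi i (k i) t). *)
Definition trig_power (k : nat -> nat) (N : nat) (t : R) : R :=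
  (N%:R^-1 * \sum_(i < N) cos (angle (k i) t)) ^+ 2 +
  (N%:R^-1 * \sum_(i < N) sin (angle (k i) t)) ^+ 2.

Lemma trig_powerE k N t : trig_power k N t =
  N%:R^-1 ^+ 2 * \sum_(i < N) \sum_(j < N) cos (angle (k i) t - angle (k j) t).
Proof.
rewrite /trig_power !exprMn -mulrDr !expr2; congr (_ * _).
rewrite !big_distrlr/= -big_split; apply: eq_bigr => i _.
by rewrite -big_split; apply: eq_bigr => j _; rewrite cosB.
Qed.

Lemma trig_power01 k N t : 0 <= trig_power k N t <= 1.
Proof.
rewrite addr_ge0 ?sqr_ge0//= trig_powerE.
have [->|N0] := posnP N; first by rewrite big_ord0 mulr0.
rewrite exprVn ler_pdivrMl ?exprn_gt0 ?ltr0n// mulr1.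
apply: (@le_trans _ _ (\sum_(i < N) \sum_(j < N) (1 : R))).
  by apply: ler_sum => i _; apply: ler_sum => j _; exact: cos_le1.
by rewrite !sumr_const card_ord -mulrnA -natrX.
Qed.

Lemma trig_power_cont k N : continuous (trig_power k N).
Proof.
have ac n : continuous (@angle R n).
  by move=> t; apply: cvgM; [exact: cvg_cst|exact: cvg_id].
move=> t; apply: cvgD; apply: cvgM; apply: cvgM; try exact: cvg_cst.
- by apply: cvg_sumr => i; apply: continuous_comp; [exact: ac|exact: continuous_cos].
- by apply: cvg_sumr => i; apply: continuous_comp; [exact: ac|exact: continuous_cos].
- by apply: cvg_sumr => i; apply: continuous_comp; [exact: ac|exact: continuous_sin].
- by apply: cvg_sumr => i; apply: continuous_comp; [exact: ac|exact: continuous_sin].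
Qed.

Lemma trig_power_id_end N : (0 < N)%N ->
  trig_power id N 0 = 1 /\ trig_power id N 1 = 1.
Proof.
move=> N0; have NN : N%:R != 0 :> R by rewrite pnatr_eq0 -lt0n.
have s t : (forall n, cos (angle n t) = 1) -> (forall n, sin (angle n t) = 0) ->
    trig_power id N t = 1.
  move=> ct st; rewrite /trig_power (eq_bigr (fun=> 1)) => [|i _]; last exact: ct.
  rewrite [X in _ + (_ * X) ^+ 2]big1 => [|i _]; last exact: st.
  by rewrite sumr_const card_ord mulr0 expr0n addr0 mulVf// expr1n.
have an n : angle n 1 = 0 + (pi *+ 2) *+ n :> R.
  by rewrite /angle mulr1 add0r mulr_natr mulr_natl.
split; apply: s => n; rewrite ?an.
- by rewrite /angle mulr0 cos0.
- by rewrite /angle mulr0 sin0.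
- by rewrite (periodicn (@cosD2pi R)) cos0.
- by rewrite (periodicn (@sinD2pi R)) sin0.
Qed.

End trig_power.

Lemma pfun_trig_power (R : realType) (C : nat -> nat -> R)
    (L : (R -> R) -> R) k N :
  @positive_functional R R `[0, 1] L ->
  (forall p q, L (fun t => cos (angle p t - angle q t)) = C p q) ->
  L (trig_power k N) =
  N%:R^-1 ^+ 2 * \sum_(i < N) \sum_(j < N) C (k i) (k j).
Proof.
move=> Lp LC.
have cb p q : @bounded_on R R `[0, 1] (fun t => cos (angle p t - angle q t)).
  by exists 1 => t _; exact: cos_max.
transitivity (L (fun t => N%:R^-1 ^+ 2 *
    \sum_(i < N) \sum_(j < N) cos (angle (k i) t - angle (k j) t))).
  by congr L; apply/funext => t; rewrite trig_powerE.
rewrite (pfunZ Lp); last by do 2 (apply: bounded_on_sum => ?).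
congr (_ * _).
rewrite (pfun_sum (h := fun (i : 'I_N) t =>
  \sum_(j < N) cos (angle (k i) t - angle (k j) t)) _ Lp).
  apply: eq_bigr => i _.
  rewrite (pfun_sum (h := fun (j : 'I_N) t =>
    cos (angle (k i) t - angle (k j) t)) _ Lp)//.
  by apply: eq_bigr => j _.
by move=> i; exact: bounded_on_sum.
Qed.

(** A positive functional L represents C, so both averages of C are the values
    of L at trigonometric powers. Those along k tend to 0 inside [0, 1], but at
    the end points they equal 1. Multiplying them by 1 - trig_power id H, which
    vanishes at the end points, gives functions to which bounded convergence
    applies; the remainder is at most trig_power id H, and L of it is small for
    large H by the hypothesis on the consecutive times. *)
Theorem stationary_mean_square (R : realType) (C : nat -> nat -> R) (k : nat -> nat) :
  (forall i j, C i j = C j i) -> (forall i j, C i.+1 j.+1 = C i j) ->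
  (forall n (x : nat -> R),
    0 <= \sum_(i < n) \sum_(j < n) x i * x j * C i j) ->
  (fun N => N%:R^-1 ^+ 2 * \sum_(i < N) \sum_(j < N) C i j) @ \oo --> (0 : R) ->
  (forall t : R, 0 < t < 1 -> trig_power k ^~ t @ \oo --> (0 : R)) ->
  (fun N => N%:R^-1 ^+ 2 * \sum_(i < N) \sum_(j < N) C (k i) (k j)) @ \oo
    --> (0 : R).
Proof.
move=> C_sym C_shift C_pos C_mean k_mean.
have [L [Lp LC]] := herglotz C_sym C_shift C_pos.
have tb j N : @bounded_on R R `[0, 1] (trig_power j N).
  by exists 1 => t _; have /andP[? ?] := trig_power01 j N t; rewrite ger0_norm.
under eq_cvg do rewrite -(pfun_trig_power _ _ Lp LC).
apply/cvgr0Pnorm_lt => e e0.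
have e2 : 0 < e / 2 by rewrite divr_gt0.
have := C_mean; under eq_cvg do rewrite -(pfun_trig_power id _ Lp LC).
move=> /cvgr0Pnorm_lt/(_ _ e2)[H0 _ /(_ H0.+1 (leqnSn _))].
set H := H0.+1; rewrite /= => HL.
pose g N (t : R) := trig_power k N t * (1 - trig_power id H t).
have gL : L \o g @ \oo --> (0 : R).
  apply: (pfun_bounded_convergence Lp (@segment_compact R 0 1)).
  - move=> N t; apply: cvgM; first exact: trig_power_cont.
    by apply: cvgB; [exact: cvg_cst|exact: trig_power_cont].
  - move=> N t _; have := trig_power01 k N t; have := trig_power01 id H t.
    move=> /andP[h0 h1] /andP[k0 k1].
    by rewrite mulr_ge0 ?subr_ge0//= mulr_ile1// ?subr_ge0// lerBlDr lerDl.
  - move=> t /=; rewrite in_itv/= => /andP[t0 t1].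
    have [T0 T1] := @trig_power_id_end R H isT.
    have [->|tn0] := eqVneq t 0.
      by rewrite /g T0 subrr; under eq_cvg do rewrite mulr0; exact: cvg_cst.
    have [->|tn1] := eqVneq t 1.
      by rewrite /g T1 subrr; under eq_cvg do rewrite mulr0; exact: cvg_cst.
    have -> : 0 = 0 * (1 - trig_power id H t) by rewrite mul0r.
    apply: cvgM; last exact: cvg_cst.
    by apply: k_mean; rewrite !lt_neqAle eq_sym tn0 t0 tn1 t1.
have Lge0 j N : 0 <= L (trig_power j N).
  by apply: (pfun_ge0 Lp) => // t _; have /andP[] := trig_power01 j N t.
move/cvgr0Pnorm_lt : gL => /(_ _ e2); apply: filterS => N /=.
rewrite (ger0_norm (Lge0 _ _)) => gN.
have gb : @bounded_on R R `[0, 1] (g N).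
  by apply: bounded_on_mul => //; apply: bounded_on_sub => //; exact: bounded_on_cst.
apply: (@le_lt_trans _ _ (L (fun t => g N t + trig_power id H t))).
  apply: (pfun_le Lp) => //; first exact: bounded_on_add.
  move=> t _; rewrite /g; have := trig_power01 k N t; have := trig_power01 id H t.
  by nra.
rewrite (pfunD Lp)//; have := ler_norm (L (g N)); move: HL gN.
by rewrite (ger0_norm (Lge0 _ _)); lra.
Qed.

(** * Invariant measures and the maximal inequality *)

Section bounded_measurable.
Context d (T : measurableType d) (R : realType) (P : probability T R).

Definition bounded_measurable (h : T -> R) : Prop :=
  measurable_fun [set: T] h /\ exists B, forall x, `|h x| <= B.

Implicit Types h k : T -> R.

Lemma bmeas_integrable h : bounded_measurable h ->
  P.-integrable [set: T] (EFin \o h).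
Proof.
move=> [mh [B hB]]; apply: measurable_bounded_integrable => //.
  by apply: fin_num_fun_lty; exact: fin_num_measure.
exists B; split; first exact: num_real.
by move=> M BM x _; exact: le_trans (hB x) (ltW BM).
Qed.

Lemma bmeas_cst (c : R) : bounded_measurable (fun=> c).
Proof. by split; [exact: measurable_cst|exists `|c|]. Qed.

Lemma bmeasD h k : bounded_measurable h -> bounded_measurable k ->
  bounded_measurable (fun x => h x + k x).
Proof.
move=> [mh [B hB]] [mk [B' kB]]; split; first exact: measurable_funD.
by exists (B + B') => x; rewrite (le_trans (ler_normD _ _))// lerD.
Qed.

Lemma bmeasM h k : bounded_measurable h -> bounded_measurable k ->
  bounded_measurable (fun x => h x * k x).
Proof.
move=> [mh [B hB]] [mk [B' kB]]; split; first exact: measurable_funM.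
by exists (B * B') => x; rewrite normrM ler_pM.
Qed.

Lemma bmeasZ (c : R) h : bounded_measurable h ->
  bounded_measurable (fun x => c * h x).
Proof. by apply: bmeasM; exact: bmeas_cst. Qed.

Lemma bmeasB h k : bounded_measurable h -> bounded_measurable k ->
  bounded_measurable (fun x => h x - k x).
Proof.
move=> bh bk; rewrite (_ : (fun x => _) = fun x => h x + (-1) * k x).
  by apply: bmeasD => //; exact: bmeasZ.
by apply/funext => x; rewrite mulN1r.
Qed.

Lemma bmeas_sum (I : Type) (s : seq I) (h : I -> T -> R) :
  (forall i, bounded_measurable (h i)) ->
  bounded_measurable (fun x => \sum_(i <- s) h i x).
Proof.
move=> bh; elim: s => [|i s IHs].
  under eq_fun do rewrite big_nil; exact: bmeas_cst.
by under eq_fun do rewrite big_cons; exact: bmeasD.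
Qed.

Lemma bmeas_comp (f : T -> T) h : measurable_fun [set: T] f ->
  bounded_measurable h -> bounded_measurable (h \o f).
Proof.
move=> mf [mh [B hB]]; split; first exact: measurableT_comp.
by exists B => x; exact: hB.
Qed.

Lemma bmeas_indic (A : set T) : measurable A -> bounded_measurable (\1_A : T -> R).
Proof.
move=> mA; split; first exact: measurable_indic.
by exists 1 => x; rewrite indicE normr_nat lern1 leq_b1.
Qed.

Lemma measurable_gt h (c : R) : measurable_fun [set: T] h ->
  measurable [set x | c < h x].
Proof.
move=> /(_ measurableT [set` `]c, +oo[] (measurable_itv _)).
rewrite setTI; congr measurable; apply/seteqP; split=> x /=.
  by rewrite in_itv/= andbT.
by rewrite in_itv/= andbT.
Qed.

Lemma Rintegral_sum (I : Type) (s : seq I) (h : I -> T -> R) :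
  (forall i, bounded_measurable (h i)) ->
  \int[P]_x (\sum_(i <- s) h i x) = \sum_(i <- s) \int[P]_x h i x.
Proof.
move=> bh; elim: s => [|i s IHs].
  rewrite big_nil; under eq_Rintegral do rewrite big_nil.
  by rewrite Rintegral_cst// mul0r.
under eq_Rintegral do rewrite big_cons.
rewrite big_cons -IHs RintegralD//; apply: bmeas_integrable => //.
exact: bmeas_sum.
Qed.

Lemma Rintegral_prob_cst (c : R) : \int[P]_x c = c.
Proof.
transitivity (c * fine (P [set: T])); first exact: Rintegral_cst.
by rewrite probability_setT mulr1.
Qed.

Lemma Rintegral_bounded_cvg (h_ : nat -> T -> R) h (B : R) :
  (forall n, measurable_fun [set: T] (h_ n)) -> measurable_fun [set: T] h ->
  (forall n x, `|h_ n x| <= B) ->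
  {ae P, forall x, h_ ^~ x @ \oo --> h x} ->
  (fun n => \int[P]_x h_ n x) @ \oo --> \int[P]_x h x.
Proof.
move=> mh_ mh hB hcv.
have := @dominated_convergence _ _ _ P [set: T] measurableT
  (fun n => EFin \o h_ n) (EFin \o h) (EFin \o cst B).
case.
- by move=> n; apply/measurable_EFinP.
- by apply/measurable_EFinP.
- by apply: filterS hcv => x hx _; apply/cvg_EFin => //; exact: nearW.
- by apply: bmeas_integrable; exact: bmeas_cst.
- by apply: aeW => x n _ /=; rewrite lee_fin.
by move=> ih _; rewrite -(fineK (integrable_fin_num measurableT ih)) => /fine_cvgP[].
Qed.

End bounded_measurable.

Section ergodic.
Context d (T : measurableType d) (R : realType) (P : probability T R).
Variable f : T -> T.
Hypothesis mf : measurable_fun [set: T] f.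
Hypothesis Pf : forall A, measurable A -> P (f @^-1` A) = P A.

Implicit Types h : T -> R.

Lemma Rintegral_comp h : bounded_measurable h ->
  \int[P]_x h (f x) = \int[P]_x h x.
Proof.
move=> bh; have [mh _] := bh; congr fine.
have mh' : measurable_fun [set: T] (EFin \o h) by exact/measurable_EFinP.
have /= <- := integral_pushforward mf mh'
  (bmeas_integrable P (bmeas_comp mf bh)) measurableT.
by apply: eq_measure_integral => A mA _; exact: Pf.
Qed.

Lemma Rintegral_iter h n : bounded_measurable h ->
  \int[P]_x h (iter n f x) = \int[P]_x h x.
Proof.
move=> bh; elim: n => // n IHn; rewrite -[RHS]IHn.
have bn : bounded_measurable (fun x => h (iter n f x)).
  apply: (bmeas_comp (f := iter n f)) => //.
  elim: n {IHn} => [|n IHn]; first exact: measurable_id.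
  exact: measurableT_comp.
by rewrite -[RHS](Rintegral_comp bn); apply: eq_Rintegral => x _; rewrite -iterSr.
Qed.

Lemma bmeas_iter h n : bounded_measurable h ->
  bounded_measurable (fun x => h (iter n f x)).
Proof.
move=> bh; apply: (bmeas_comp (f := iter n f)) => //.
elim: n => [|n IHn]; first exact: measurable_id.
exact: measurableT_comp.
Qed.

Definition orbit_sum h n x : R := \sum_(i < n) h (iter i f x).

Lemma orbit_sumS h n x : orbit_sum h n.+1 x = h x + orbit_sum h n (f x).
Proof.
rewrite /orbit_sum big_ord_recl; congr (_ + _).
by apply: eq_bigr => i _; rewrite -iterSr.
Qed.

Lemma bmeas_orbit_sum h n : bounded_measurable h ->
  bounded_measurable (orbit_sum h n).
Proof. by move=> bh; apply: bmeas_sum => i; exact: bmeas_iter. Qed.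

(** The maximum of 0 and of the first n partial orbit sums of h, in the
    recursive form that relates it to its value at f x. *)
Fixpoint orbit_max h n x : R :=
  if n is m.+1 then Num.max 0 (h x + orbit_max h m (f x)) else 0.

Lemma orbit_max_ge0 h n x : 0 <= orbit_max h n x.
Proof. by case: n => //= n; rewrite le_max lexx. Qed.

Lemma orbit_max_mono h n x : orbit_max h n x <= orbit_max h n.+1 x.
Proof.
elim: n x => [|n IHn] x; first by rewrite le_max lexx.
rewrite [leLHS]/= [leRHS]/= ge_max le_max lexx/= le_max; apply/orP; right.
by rewrite lerD2l; exact: IHn.
Qed.

Lemma orbit_sum_le_max h n x : orbit_sum h n x <= orbit_max h n x.
Proof.
elim: n x => [|n IHn] x; first by rewrite /orbit_sum big_ord0.
by rewrite orbit_sumS /= le_max lerD2l IHn orbT.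
Qed.

Lemma bmeas_orbit_max h n : bounded_measurable h ->
  bounded_measurable (orbit_max h n).
Proof.
move=> bh; elim: n => [|n IHn]; first exact: bmeas_cst.
have [mk [B kB]] := bmeasD bh (bmeas_comp mf IHn).
split; first exact: measurable_maxr.
exists B => x /=; rewrite ger0_norm ?le_max ?lexx// ge_max.
rewrite (le_trans _ (kB x))//=; exact: le_trans (ler_norm _) (kB x).
Qed.

(** Garsia's argument. Where orbit_max h n is positive, its recursive form and
    its monotonicity in n give h x >= orbit_max h n x - orbit_max h n (f x);
    elsewhere the right-hand side is at most 0. The right-hand side has
    integral 0 by invariance. *)
Lemma maximal_ergodic h n : bounded_measurable h ->
  0 <= \int[P]_x (h x * \1_[set y | 0 < orbit_max h n y] x).
Proof.
move=> bh; have [mm _] := bmeas_orbit_max n bh.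
have mE := measurable_gt 0 mm.
have bm := bmeas_orbit_max n bh.
have bmf : bounded_measurable (fun x => orbit_max h n (f x)) by exact: bmeas_comp.
rewrite [leLHS](_ : 0 = \int[P]_x (orbit_max h n x - orbit_max h n (f x))).
2:{ by rewrite RintegralB ?Rintegral_comp ?subrr//; exact: bmeas_integrable. }
apply: le_Rintegral => //.
- by apply: bmeas_integrable; exact: bmeasB.
- by apply: bmeas_integrable; apply: bmeasM => //; exact: bmeas_indic.
move=> x _; rewrite indicE (_ : (x \in _) = (0 < orbit_max h n x)); last first.
  by apply/idP/idP; rewrite inE.
have [m0|m0] := ltP 0 (orbit_max h n x); last first.
  by rewrite mulr0 subr_le0 (le_trans m0)// orbit_max_ge0.
rewrite mulr1 lerBlDr; case: n m0 {mm mE bm bmf} => [|n]; first by rewrite ltxx.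
have := orbit_max_mono h n (f x); set v := orbit_max h n.+1 (f x).
by rewrite /= lt_max ltxx/= ge_max => uv u0; apply/andP; split; lra.
Qed.

Hypothesis f_ergodic : forall A, measurable A -> f @^-1` A = A ->
  (0 < P A)%E -> P A = 1%E.

(** The set E on which the orbit sums are unbounded above is invariant: h is
    bounded and the sums at x and f x differ by h x. If E had positive measure,
    it would have measure 1 by ergodicity; then orbit_max h n would eventually
    be positive at almost every point, and the maximal inequality would yield
    in the limit that h has nonnegative integral. *)
Lemma orbit_sum_bounded h : bounded_measurable h -> \int[P]_x h x < 0 ->
  {ae P, forall x, exists B, forall n, orbit_sum h n x <= B}.
Proof.
move=> bh h0; have [mh [B hB]] := bh.
pose E := \bigcap_k \bigcup_n [set x | k%:R < orbit_sum h n x].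
have mG (k : nat) n : measurable [set x | k%:R < orbit_sum h n x].
  have [mS _] := bmeas_orbit_sum n bh.
  exact: measurable_gt mS.
have mE : measurable E.
  by apply: bigcapT_measurable => k; apply: bigcupT_measurable => n.
have fE : f @^-1` E = E.
  have [m Bm] : exists m : nat, B <= m%:R.
    exists (Num.bound B).
    exact: ltW (archi_boundP (le_trans (normr_ge0 _) (hB point))).
  have Bh x : - m%:R <= h x <= m%:R.
    by rewrite -ler_norml (le_trans (hB x)).
  apply/seteqP; split=> x Ex k _ /=.
    have [n _ /= kn] := Ex (k + m)%N I; exists n.+1 => //=.
    by rewrite orbit_sumS; have := Bh x; move: kn; rewrite natrD; lra.
  have [n _ /=] := Ex (k + m)%N I; case: n => [|n].
    by rewrite /orbit_sum big_ord0 ltNge ler0n.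
  rewrite orbit_sumS natrD => kn; exists n => //=.
  by have := Bh x; move: kn; lra.
have PE : P E = 0%E.
  apply/eqP; rewrite eq_le measure_ge0 andbT leNgt; apply/negP => PE0.
  have PE1 := f_ergodic mE fE PE0.
  suff : (fun n => \int[P]_x (h x * \1_[set y | 0 < orbit_max h n y] x)) @ \oo
      --> \int[P]_x h x.
    move=> cv; move: h0; rewrite ltNge => /negP; apply.
    rewrite -(cvg_lim _ cv)//; apply: limr_ge; first exact: cvgP cv.
    by apply: nearW => n; exact: maximal_ergodic.
  have mM n : measurable [set y | 0 < orbit_max h n y].
    by apply: measurable_gt; have [] := bmeas_orbit_max n bh.
  apply: (@Rintegral_bounded_cvg _ _ _ _ _ _ B) => //.
  - by move=> n; apply: measurable_funM => //; exact: measurable_indic.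
  - move=> n x; rewrite normrM indicE normr_nat (le_trans _ (hB x))//.
    by rewrite ler_piMr// lern1 leq_b1.
  - exists (~` E); split; first exact: measurableC.
      by rewrite probability_setC// PE1 subee.
    move=> x /= ncv Ex; apply: ncv.
    have [n _ /=] := Ex 0%N I; move=> /lt_le_trans/(_ (orbit_sum_le_max h n x)) n0.
    apply: cvg_near_cst; exists n => // m /= nm.
    have nm0 : 0 < orbit_max h m x.
      elim: m nm => [|m IHm]; first by rewrite leqn0 => /eqP <-.
      rewrite leq_eqVlt => /predU1P[<-//|nm].
      by apply: lt_le_trans (IHm _) (orbit_max_mono h m x).
    by rewrite indicE mem_set ?mulr1.
exists E; split=> // x /= nb k _.
apply: contrapT => nk; apply: nb; exists k%:R => n.
by rewrite leNgt; apply/negP => kn; apply: nk; exists n.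
Qed.

End ergodic.

(** * The ergodic theorem *)

Section birkhoff.
Context d (T : measurableType d) (R : realType) (P : probability T R).
Variable f : T -> T.
Hypothesis mf : measurable_fun [set: T] f.
Hypothesis Pf : forall A, measurable A -> P (f @^-1` A) = P A.
Hypothesis f_ergodic : forall A, measurable A -> f @^-1` A = A ->
  (0 < P A)%E -> P A = 1%E.

(** The function h - c, where c exceeds the mean of h by 1 / (k + 1), has
    negative integral, so its orbit sums are bounded above. *)
Let upper (h : T -> R) : bounded_measurable h ->
  {ae P, forall x (k : nat), exists B, forall n,
    orbit_sum f h n x <= n%:R * (\int[P]_x h x + k.+1%:R^-1) + B}.
Proof.
move=> bh; pose c k := \int[P]_x h x + k.+1%:R^-1.
suff H k : {ae P, forall x, exists B, forall n, orbit_sum f h n x <= n%:R * c k + B}.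
  by apply/ae_foralln => k; exact: H.
have bhc : bounded_measurable (fun x => h x - c k).
  by apply: bmeasB => //; exact: bmeas_cst.
have hc0 : \int[P]_x (h x - c k) < 0.
  rewrite RintegralB//; try by apply: bmeas_integrable => //; exact: bmeas_cst.
  by rewrite Rintegral_prob_cst /c opprD addNKr oppr_lt0 invr_gt0 ltr0Sn.
apply: filterS (orbit_sum_bounded mf Pf f_ergodic bhc hc0) => x [B hB].
exists B => n; have := hB n; rewrite /orbit_sum sumrB sumr_const card_ord.
by rewrite -[c k *+ n]mulr_natl; lra.
Qed.

(** The previous bound for h and for -h encloses the averages within k.+1%:R^-1
    of the mean, up to a term of order 1 / n. *)
Theorem birkhoff (h : T -> R) : bounded_measurable h ->
  {ae P, forall x, (fun n => n%:R^-1 * orbit_sum f h n x) @ \oo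
    --> \int[P]_x h x}.
Proof.
move=> bh; have bNh : bounded_measurable (fun x => (-1) * h x) by exact: bmeasZ.
apply: filterS2 (upper bh) (upper bNh) => x ux lx.
set c := \int[P]_x h x in ux *.
have cN : \int[P]_y (-1 * h y) = - c.
  by rewrite RintegralZl ?mulN1r//; exact: bmeas_integrable.
rewrite {}cN in lx.
apply/cvgrPdist_le => e e0.
have e2 : 0 < e / 2 by rewrite divr_gt0.
have [k ke] : exists k : nat, k.+1%:R^-1 < e / 2.
  have /cvgr0Pnorm_lt/(_ _ e2)[k _ /(_ k (leqnn k))] := @cvg_harmonic R.
  by rewrite /= ger0_norm ?invr_ge0// => ?; exists k.
have [B1 hB1] := ux k; have [B2 hB2] := lx k.
pose B := `|B1| + `|B2|.
have : (fun n => n%:R^-1 * B) @ \oo --> 0 * B.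
  by apply: cvgM; [exact: cvg_invn|exact: cvg_cst].
rewrite mul0r => /cvgr0Pnorm_lt/(_ _ e2) nB.
near=> n.
have n0 : 0 < n%:R :> R by rewrite ltr0n; near: n; exact: nbhs_infty_gt.
have : `|n%:R^-1 * B| < e / 2 by near: n.
rewrite ger0_norm; last by rewrite mulr_ge0 ?invr_ge0 ?(ltW n0)// addr_ge0.
rewrite mulrC ltr_pdivrMr// => nB1.
have := hB1 n; have := hB2 n.
rewrite /orbit_sum -mulr_sumr mulN1r -/(orbit_sum f h n x); set s := orbit_sum _ _ _ _.
move=> s1 s2; have -> : c - n%:R^-1 * s = n%:R^-1 * (n%:R * c - s).
  by field; rewrite gt_eqF.
rewrite normrM gtr0_norm ?invr_gt0// ler_pdivrMl//.
have nk : n%:R * k.+1%:R^-1 <= n%:R * (e / 2) by rewrite ler_pM2l// ltW.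
have := ler_norm B1; have := ler_norm B2; rewrite /B in nB1.
have := normr_ge0 B1; have := normr_ge0 B2.
move: s1 s2 nk nB1; rewrite !mulrDr mulrN ler_norml.
set nR := n%:R; set q := _^-1 => *; apply/andP; split; lra.
Unshelve. all: by end_near. Qed.

Corollary mean_ergodic (h : T -> R) : bounded_measurable h ->
  (fun n => \int[P]_x ((n%:R^-1 * orbit_sum f h n x - \int[P]_y h y) ^+ 2)) @ \oo
    --> (0 : R).
Proof.
move=> bh; set c := \int[P]_y h y; have [mh [B hB]] := bh.
have B0 : 0 <= B := le_trans (normr_ge0 _) (hB point).
rewrite -[X in _ --> X](Rintegral_prob_cst P).
have avgB n x : `|n%:R^-1 * orbit_sum f h n x| <= B.
  have [->|n0] := posnP n; first by rewrite invr0 mul0r normr0.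
  rewrite normrM gtr0_norm ?invr_gt0 ?ltr0n// ler_pdivrMl ?ltr0n//.
  rewrite (le_trans (ler_norm_sum _ _ _))// mulr_natl -[X in _ *+ X](card_ord n).
  by rewrite -sumr_const; apply: ler_sum => i _.
apply: (@Rintegral_bounded_cvg _ _ _ _ _ _ ((B + `|c|) ^+ 2)).
- move=> n; apply: measurable_funX; apply: measurable_funB => //.
  by apply: measurable_funM => //; have [] := bmeas_orbit_sum mf n bh.
- exact: measurable_cst.
- move=> n x; rewrite normrX lerXn2r ?nnegrE ?addr_ge0//.
  by rewrite (le_trans (ler_normB _ _))// lerD2r.
apply: filterS (birkhoff bh) => x hx.
have -> : (0 : R) = (c - c) ^+ 2 by rewrite subrr expr0n.
by apply: cvgM; (apply: cvgB; [exact: hx|exact: cvg_cst]).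
Qed.

End birkhoff.

(** * Mean convergence along a sequence of times *)

Section stationary_process.
Context d (T : measurableType d) (R : realType) (P : probability T R).
Variable f : T -> T.
Hypothesis mf : measurable_fun [set: T] f.
Hypothesis Pf : forall A, measurable A -> P (f @^-1` A) = P A.

Definition correlation (u : T -> R) (i j : nat) : R :=
  \int[P]_x (u (iter i f x) * u (iter j f x)).

Variable u : T -> R.
Hypothesis bu : bounded_measurable u.

Let bui i : bounded_measurable (fun x => u (iter i f x)) := bmeas_iter mf i bu.

Lemma correlation_shift i j : correlation u i.+1 j.+1 = correlation u i j.
Proof.
rewrite /correlation -(Rintegral_comp mf Pf (bmeasM (bui i) (bui j))).
by apply: eq_Rintegral => x _; rewrite !iterSr.
Qed.

Lemma correlation_square n (x : nat -> R) (k : nat -> nat) :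
  \int[P]_y ((\sum_(i < n) x i * u (iter (k i) f y)) ^+ 2) =
  \sum_(i < n) \sum_(j < n) x i * x j * correlation u (k i) (k j).
Proof.
have E i j : x i * x j * correlation u (k i) (k j) =
    \int[P]_y (x i * x j * (u (iter (k i) f y) * u (iter (k j) f y))).
  by rewrite RintegralZl//; apply: bmeas_integrable; exact: bmeasM.
under [RHS]eq_bigr do under eq_bigr do rewrite E.
under [RHS]eq_bigr => i _.
  rewrite -(Rintegral_sum P _ (h := fun (j : 'I_n) y =>
    x i * x j * (u (iter (k i) f y) * u (iter (k j) f y)))); last first.
    by move=> j; apply: bmeasZ; exact: bmeasM.
  over.
rewrite -(Rintegral_sum P _ (h := fun (i : 'I_n) y => \sum_(j < n)
    x i * x j * (u (iter (k i) f y) * u (iter (k j) f y)))); last first.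
  by move=> i; apply: bmeas_sum => j; apply: bmeasZ; exact: bmeasM.
apply: eq_Rintegral => y _; rewrite expr2 big_distrlr/=.
by apply: eq_bigr => i _; apply: eq_bigr => j _; ring.
Qed.

End stationary_process.

(** For every sequence of times, the mean square is the average of the
    correlations of h - c, which form a stationary positive definite kernel.
    For the consecutive times it tends to 0 by ergodicity, and the spectral
    argument transfers this to the times k. *)
Theorem mean_ergodic_along d (T : measurableType d) (R : realType)
    (P : probability T R) (f : T -> T) (k : nat -> nat) (h : T -> R) :
  measurable_fun [set: T] f ->
  (forall A, measurable A -> P (f @^-1` A) = P A) ->
  (forall A, measurable A -> f @^-1` A = A -> (0 < P A)%E -> P A = 1%E) ->
  (forall t : R, 0 < t < 1 -> trig_power k ^~ t @ \oo --> (0 : R)) ->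
  bounded_measurable h ->
  (fun N => \int[P]_x
    ((N%:R^-1 * \sum_(i < N) h (iter (k i) f x) - \int[P]_y h y) ^+ 2)) @ \oo
    --> (0 : R).
Proof.
move=> mf Pf erg k_mean bh; set c := \int[P]_y h y.
pose u x := h x - c.
have bu : bounded_measurable u by apply: bmeasB => //; exact: bmeas_cst.
have E (l : nat -> nat) N : (0 < N)%N ->
    \int[P]_x ((N%:R^-1 * \sum_(i < N) h (iter (l i) f x) - c) ^+ 2) =
    N%:R^-1 ^+ 2 * \sum_(i < N) \sum_(j < N) correlation P f u (l i) (l j).
  move=> N0; have N0r : N%:R != 0 :> R by rewrite pnatr_eq0 -lt0n.
  transitivity (\int[P]_y ((\sum_(i < N) N%:R^-1 * u (iter (l i) f y)) ^+ 2)).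
    apply: eq_Rintegral => y _; congr (_ ^+ 2).
    rewrite -mulr_sumr sumrB sumr_const card_ord -[c *+ N]mulr_natl.
    by field.
  rewrite (correlation_square _ mf bu N (fun=> N%:R^-1) l).
  rewrite mulr_sumr; apply: eq_bigr => i _; rewrite mulr_sumr.
  by apply: eq_bigr => j _; rewrite expr2.
apply: cvg_trans; last first.
  apply: (stationary_mean_square (C := correlation P f u) _ _ _ _ k_mean).
  - by move=> i j; apply: eq_Rintegral => x _; rewrite mulrC.
  - by move=> i j; exact: correlation_shift.
  - move=> n x; rewrite -(correlation_square _ mf bu n x id).
    by apply: Rintegral_ge0 => y _; rewrite sqr_ge0.
  - apply: cvg_trans (mean_ergodic mf Pf erg bh).
    by apply: near_eq_cvg; near=> N; rewrite -(E id)//; near: N; exact: nbhs_infty_gt.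
by apply: near_eq_cvg; near=> N; rewrite -E//; near: N; exact: nbhs_infty_gt.
Unshelve. all: by end_near. Qed.

Lemma uniformly_behaved_trig_power (R : realType) (a : nat -> nat) :
  uniformly_behaved R a ->
  forall t : R, 0 < t < 1 ->
    trig_power (fun i => a i.+1) ^~ t @ \oo --> (0 : R).
Proof.
move=> ub t t01; have cv := ub t t01.
pose z N : R[i]^o := Defs.cesaro (fun n => expi (2 * pi * (a n)%:R * t)) N.
have zE N : z N = (N%:R^-1 * \sum_(i < N) cos (angle (a i.+1) t)) +i*
    (N%:R^-1 * \sum_(i < N) sin (angle (a i.+1) t)).
  rewrite /z /Defs.cesaro big_add1/= big_mkord.
  have -> : N%:R^-1 = (N%:R^-1)%:C :> R[i] by rewrite fmorphV/= rmorph_nat.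
  have -> : \sum_(i < N) expi (2 * pi * (a i.+1)%:R * t) =
      (\sum_(i < N) cos (angle (a i.+1) t)) +i* (\sum_(i < N) sin (angle (a i.+1) t)).
    elim/big_ind3: _ => // x1 x2 x3 y1 y2 y3 -> ->.
    by [].
  by apply/eqP; rewrite eq_complex/= !mul0r subr0 addr0 !eqxx.
have z2 : (fun N => z N * z N) @ \oo --> (0 : R[i]^o).
  by rewrite -(mulr0 (0 : R[i])); apply: cvgM; exact: cv.
apply/cvgr0Pnorm_lt => e e0.
have e0C : 0 < e%:C :> R[i] by rewrite ltcR.
move/cvgr0Pnorm_lt : z2 => /(_ _ e0C); apply: filterS => N.
rewrite normrM -expr2 -add_Re2_Im2 zE/= ltcR => zN.
by rewrite ger0_norm//; have /andP[] := trig_power01 (fun i => a i.+1) N t.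
Qed.

(** * Borel dynamics and functions on compact metric spaces *)

Section borel_dynamics.
Context {R : realType} {Y : ptopologicalType} (g : Y -> Y).

Lemma continuous_borel_map : continuous g ->
  measurable_fun [set: borel Y] (g : borel Y -> borel Y).
Proof.
move=> /continuousP cg.
apply: (@measurability _ _ (borel Y) (borel Y) setT g (@open Y)) => //.
by move=> _ [A oA <-]; rewrite setTI; apply: sub_sigma_algebra; exact: cg.
Qed.

Lemma continuous_borel_fun (h : Y -> R) : continuous h ->
  measurable_fun [set: borel Y] (h : borel Y -> R).
Proof.
move=> /continuousP ch; apply: (measurability _ (RGenOpens.measurableE R)).
move=> _ [_ [a [b ->]] <-]; rewrite setTI; apply: sub_sigma_algebra.
by apply: ch; exact: interval_open.
Qed.

Variable nu : probability (borel Y) R.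
Hypothesis nu_inv : invariant_measure g nu.

(** Conditioning nu on an invariant set of positive measure gives an invariant
    probability; by uniqueness it is nu, so the set has full measure. *)
Lemma unique_invariant_ergodic :
  measurable_fun [set: borel Y] (g : borel Y -> borel Y) ->
  (forall mu : probability (borel Y) R, invariant_measure g mu ->
    forall A : set (borel Y), measurable A -> mu A = nu A) ->
  forall A : set (borel Y), measurable A -> g @^-1` A = A ->
    (0 < nu A)%E -> nu A = 1%E.
Proof.
move=> mg nu_uniq E mE gE E0.
pose cond : probability (borel Y) R := mnormalize (mrestr nu mE) nu.
have condE A : cond A = (nu (A `&` E) * (fine (nu E))^-1%:E)%E.
  rewrite /cond /= /mnormalize /= /mrestr setTI.
  by rewrite gt_eqF//= lt_eqF// ltey_eq fin_num_measure.
have condI : invariant_measure g cond.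
  move=> A mA; rewrite !condE; congr (_ * _)%E.
  by rewrite -{1}gE -preimage_setI nu_inv//; exact: measurableI.
rewrite -(nu_uniq _ condI E mE) condE setIid.
have Efin : nu E \is a fin_num by exact: fin_num_measure.
by rewrite -{1}(fineK Efin) -EFinM divff// fine_eq0// gt_eqF.
Qed.

Lemma invariant_iter n (A : set (borel Y)) :
  measurable_fun [set: borel Y] (g : borel Y -> borel Y) ->
  measurable A -> nu (iter n g @^-1` A) = nu A.
Proof.
move=> mg; elim: n A => [//|n IHn] A mA.
have mgA : measurable (g @^-1` A : set (borel Y)).
  by rewrite -[X in measurable X]setTI; exact: mg.
rewrite -[RHS](nu_inv mA) -(IHn _ mgA).
by congr (nu _); apply/seteqP; split=> x /=; rewrite -iterS.
Qed.

(** The preimages of O under the iterates of g cover the space and have the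
    same measure as O. *)
Lemma open_measure_gt0 (O : set Y) : continuous g -> open O ->
  (forall y, exists n, O (iter n g y)) -> (0 < nu O)%E.
Proof.
move=> cg oO hit; have mg := continuous_borel_map cg.
have mO : measurable (O : set (borel Y)) by exact: sub_sigma_algebra.
rewrite lt_neqAle measure_ge0 andbT eq_sym; apply/eqP => O0.
have mi n : measurable_fun [set: borel Y] (iter n g : borel Y -> borel Y).
  elim: n => [|n IHn]; first exact: measurable_id.
  exact: (measurableT_comp mg IHn).
have mOn n : measurable (iter n g @^-1` O : set (borel Y)).
  by rewrite -[X in measurable X]setTI; exact: mi.
have : nu.-negligible [set: borel Y].
  have H n : nu.-negligible (iter n g @^-1` O : set (borel Y)).
    by apply/negligibleP => //; exact: etrans (invariant_iter n mg mO) O0.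
  apply: negligibleS (negligible_bigcup H) => y _.
  by have [n On] := hit y; exists n.
move/negligibleP => /(_ measurableT) nuT0.
have /eqP := etrans (esym (probability_setT nu)) nuT0.
by rewrite onee_eq0.
Qed.

End borel_dynamics.

Section compact_metric.
Context {R : realType} {X : metricType R}.
Hypothesis cX : compact [set: X].

Lemma compact_fun_bounded (phi : X -> R) : continuous phi ->
  exists B, forall x, `|phi x| <= B.
Proof.
move=> cphi; have := @continuous_compact _ _ phi [set: X] _ cX.
case/(_ (continuous_subspaceT cphi))/compact_bounded => B [_ hB].
by exists (B + 1) => x; apply: hB; [rewrite ltrDl|exists x].
Qed.

Lemma compact_fun_uniform (phi : X -> R) (e : R) : continuous phi -> 0 < e ->
  exists2 delta, 0 < delta & forall x y, mdist x y < delta -> `|phi x - phi y| < e.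
Proof.
move=> cphi e0; move/compact_near_coveringP : (cX).
move=> /(_ _ (0^'+ : set_system R)
  (fun delta x => forall y, mdist x y < delta -> `|phi x - phi y| < e)).
case=> [x _|delta /= d0 H].
  have e2 : 0 < e / 2 by rewrite divr_gt0.
  have /cvgrPdist_lt/(_ _ e2)/nbhs_ballP[r /= r0 xr] := cphi x.
  have r2 : 0 < r / 2 by rewrite divr_gt0.
  exists (ball x (r / 2), [set t | t < r / 2]) => /=.
    split; first exact: nbhsx_ballx.
    exact: nbhs_right_lt.
  move=> [x' t] /= [xx' tr] y x'y.
  have x'r : ball x r x' by apply: le_ball xx'; lra.
  have yr : ball x r y.
    rewrite ballEmdist/= (le_lt_trans (metric_triangle _ x' _))//.
    by move: xx'; rewrite ballEmdist/=; lra.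
  have := xr _ x'r; have := xr _ yr => /= hy hx'.
  rewrite -(subrKA (phi x)) (le_lt_trans (ler_normD _ _))// distrC.
  by lra.
exists (delta / 2); first by rewrite divr_gt0.
move=> x y xy; apply: (H (delta / 2)) => //=.
- rewrite /ball_/= sub0r normrN gtr0_norm ?divr_gt0//; lra.
- by rewrite divr_gt0.
Qed.

End compact_metric.

Lemma limn_esup_lt_near (R : realType) (u : nat -> \bar R) (l : \bar R) :
  (limn_esup u < l)%E -> \forall N \near \oo, (u N < l)%E.
Proof.
rewrite /limn_esup /limf_esup => /ereal_inf_lt[_ [A Aoo <-]] Al.
apply: filterS Aoo => N AN; apply: le_lt_trans Al.
by apply: ereal_sup_ubound; exists N.
Qed.

(** * Equidistribution in the basin of a minimal subset *)

Lemma open_mball (R : realType) (Y : metricType R) (z : Y) (r : R) :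
  open [set y | mdist z y < r].
Proof.
rewrite openE => y /= zy; apply/nbhs_ballP; exists (r - mdist z y) => /=.
  by rewrite subr_gt0.
move=> y'; rewrite ballEmdist/= => yy'.
by rewrite (le_lt_trans (metric_triangle _ y _))// -ltrBrDl.
Qed.

Section minimal_system.
Context {R : realType} {X : metricType R} {f : X -> X} {K : set X}.
Variable hK : minimal_subset f K.

Lemma minimal_inclK y : K (minimal_incl hK y).
Proof. exact: set_valP. Qed.

Lemma minimal_incl_sur x : K x -> exists y, minimal_incl hK y = x.
Proof. by move=> Kx; exists (SigSub (mem_set Kx)). Qed.

Lemma minimal_incl_iter n y :
  minimal_incl hK (iter n (minimal_restr hK) y) = iter n f (minimal_incl hK y).
Proof. by elim: n => //= n <-. Qed.

Lemma mdist_minimal_incl y y' :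
  mdist y y' = mdist (minimal_incl hK y) (minimal_incl hK y').
Proof. by []. Qed.

Lemma continuous_minimal_incl : continuous (minimal_incl hK).
Proof.
move=> y A /nbhs_ballP[e /= e0 eA]; apply/nbhs_ballP; exists e => //= y'.
by rewrite ballEmdist/= => yy'; apply: eA; rewrite ballEmdist.
Qed.

Lemma continuous_minimal_restr : continuous f -> continuous (minimal_restr hK).
Proof.
move=> cf y A /nbhs_ballP[e /= e0 eA].
have /nbhs_ballP[r /= r0 yr] := cf (minimal_incl hK y) _ (nbhsx_ballx _ _ e0).
apply/nbhs_ballP; exists r => //= y'; rewrite ballEmdist/= => yy'.
by apply: eA; have := yr (minimal_incl hK y'); rewrite !ballEmdist; exact.
Qed.

Lemma minimal_orbit_hits (z y : minimal_space hK) (r : R) : 0 < r ->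
  exists n, mdist z (iter n (minimal_restr hK) y) < r.
Proof.
move=> r0; have := minimal_dense hK (minimal_inclK y) (minimal_inclK z).
move=> /(_ _ (nbhsx_ballx _ _ r0))[_ [[n _ <-]]]; rewrite ballEmdist => zn.
by exists n; rewrite mdist_minimal_incl minimal_incl_iter.
Qed.

End minimal_system.

Lemma avg_le_exceptional (R : realType) (N : nat) (p : nat -> R) (b : pred nat)
    (e B : R) : (0 < N)%N -> 0 <= e ->
  (forall i, 0 <= p i <= B) -> (forall i, ~~ b i -> p i <= e) ->
  N%:R^-1 * \sum_(i < N) p i <=
    e + B * (N%:R^-1 * (\sum_(i < N) (b i : nat))%:R).
Proof.
move=> N0 e0 pB pe; have N0r : 0 < N%:R :> R by rewrite ltr0n.
have -> : e + B * (N%:R^-1 * (\sum_(i < N) (b i : nat))%:R) =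
    N%:R^-1 * \sum_(i < N) (e + B * (b i)%:R).
  rewrite big_split/= sumr_const card_ord -mulr_sumr natr_sum -[e *+ N]mulr_natl.
  by field; rewrite gt_eqF.
rewrite ler_pM2l ?invr_gt0//; apply: ler_sum => i _.
have /andP[p0 pB'] := pB i; case: (boolP (b i)) => bi.
  by rewrite mulr1 (le_trans pB')// lerDr.
by rewrite mulr0 addr0 pe.
Qed.

Section equidistribution.
Context {R : realType} {X : metricType R} (f : X -> X) (a : nat -> nat).
Hypotheses (cX : compact [set: X]) (cf : continuous f).
Hypothesis ub : uniformly_behaved R a.

Definition orbit_avg (phi : X -> R) (x : X) (N : nat) : R :=
  N%:R^-1 * \sum_(i < N) phi (iter (a i.+1) f x).

Lemma orbit_avg_dist (phi : X -> R) (x y : X) (N : nat) :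
  `|orbit_avg phi x N - orbit_avg phi y N| <=
  N%:R^-1 * \sum_(i < N) `|phi (iter (a i.+1) f x) - phi (iter (a i.+1) f y)|.
Proof.
rewrite /orbit_avg -mulrBr -sumrB normrM ger0_norm ?invr_ge0//.
by rewrite ler_wpM2l ?invr_ge0// ler_norm_sum.
Qed.

Section on_minimal_subset.
Context {K : set X} (hK : minimal_subset f K).
Hypothesis mls : mean_lyapunov_stable a (minimal_restr hK).

(** The times n for which a n lies in the exceptional set of mean Lyapunov
    stability have small density and cost at most twice the bound of phi; at
    the other times uniform continuity of phi applies. *)
Lemma orbit_avg_equicontinuous (phi : X -> R) (e : R) : continuous phi -> 0 < e ->
  exists2 delta, 0 < delta & \forall N \near \oo,
    forall y z : minimal_space hK, mdist y z < delta ->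
    `|orbit_avg phi (minimal_incl hK y) N - orbit_avg phi (minimal_incl hK z) N|
      <= e.
Proof.
move=> cphi e0; have [B hB] := compact_fun_bounded cX cphi.
have e2 : 0 < e / 2 by rewrite divr_gt0.
have [r r0 hr] := compact_fun_uniform cX cphi e2.
pose B' := 2 * `|B| + 1.
have B'0 : 0 < B' by rewrite ltr_wpDl// mulr_ge0.
have [s s0 [sr sB]] : exists2 s, 0 < s & s <= r /\ B' * s <= e / 2.
  exists (Num.min r (e / 2 / B')); first by rewrite lt_min r0 divr_gt0.
  by split; [rewrite ge_min lexx|rewrite mulrC -ler_pdivlMr// ge_min lexx orbT].
have [delta [E [d0 Es hE]]] := mls s0.
exists delta => //; near=> N => y z yz.
have N0 : (0 < N)%N by near: N; exact: nbhs_infty_gt.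
have EN : N%:R^-1 * (\sum_(i < N) ((a i.+1 \in E) : nat))%:R < s.
  have : ((N%:R^-1 * (count (fun n => a n \in E) (iota 1 N))%:R : R)%:E < s%:E)%E.
    by near: N; exact: limn_esup_lt_near.
  rewrite lte_fin; congr (_ * _%:R < _).
  have -> : iota 1 N = index_iota 1 N.+1 by rewrite /index_iota subSS subn0.
  by rewrite -sum1_count big_mkcond/= big_add1/= big_mkord.
apply: le_trans (orbit_avg_dist _ _ _ _) _.
apply: (@le_trans _ _ (e / 2 + B' * (N%:R^-1 *
    (\sum_(i < N) ((a i.+1 \in E) : nat))%:R))).
  apply: (avg_le_exceptional (b := fun i => a i.+1 \in E)
    (p := fun i => `|phi (iter (a i.+1) f (minimal_incl hK y)) -
                     phi (iter (a i.+1) f (minimal_incl hK z))|)) => //.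
  - exact: ltW.
  - move=> i; rewrite normr_ge0/= (le_trans (ler_normB _ _))//.
    have := hB (iter (a i.+1) f (minimal_incl hK y)).
    have := hB (iter (a i.+1) f (minimal_incl hK z)).
    by have := ler_norm B; rewrite /B'; lra.
  - move=> i /negP nE; apply/ltW/hr; apply: lt_le_trans sr.
  have := hE y z yz i.+1 isT.
  rewrite mdist_minimal_incl !minimal_incl_iter; apply.
  by move=> Ea; apply: nE; rewrite inE.
have : B' * (N%:R^-1 * (\sum_(i < N) ((a i.+1 \in E) : nat))%:R) <= B' * s.
  by rewrite ler_pM2l// ltW.
by lra.
Unshelve. all: by end_near. Qed.

Variable nu : probability (borel (minimal_space hK)) R.
Hypothesis nu_inv : invariant_measure (minimal_restr hK) nu.
Hypothesis ue : uniquely_ergodic R (minimal_restr hK).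

Lemma bmeas_minimal (phi : X -> R) : continuous phi ->
  bounded_measurable ((phi \o minimal_incl hK) : borel (minimal_space hK) -> R).
Proof.
move=> cphi; split.
  apply: continuous_borel_fun => y.
  by apply: continuous_comp; [exact: continuous_minimal_incl|exact: cphi].
by have [B hB] := compact_fun_bounded cX cphi; exists B => y; exact: hB.
Qed.

(** The averages converge to c in mean square. The ball around z has positive
    measure, so it contains points whose average is close to c once the mean
    square is small compared with that measure; equicontinuity carries the
    estimate over to z. *)
Theorem orbit_avg_minimal (phi : X -> R) (z : minimal_space hK) :
  continuous phi ->
  orbit_avg phi (minimal_incl hK z) @ \oo
    --> \int[nu]_y phi (minimal_incl hK y).
Proof.
move=> cphi; set c := \int[nu]_y _.
have cg := @continuous_minimal_restr _ _ _ _ hK cf.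
have mg := continuous_borel_map cg.
have erg : forall A : set (borel (minimal_space hK)), measurable A ->
    minimal_restr hK @^-1` A = A -> (0 < nu A)%E -> nu A = 1%E.
  apply: unique_invariant_ergodic => // mu imu A mA.
  by have [mu0 [_ mu0P]] := ue; rewrite (mu0P _ imu)// (mu0P _ nu_inv).
have bphi := bmeas_minimal cphi.
have L2 := mean_ergodic_along mg nu_inv erg (uniformly_behaved_trig_power ub) bphi.
pose F N y := (orbit_avg phi (minimal_incl hK y) N - c) ^+ 2.
have {}L2 : (fun N => \int[nu]_y F N y) @ \oo --> (0 : R).
  rewrite (_ : (fun N => _) = (fun N => \int[nu]_y ((N%:R^-1 *
      \sum_(i < N) (phi \o minimal_incl hK) (iter (a i.+1) (minimal_restr hK) y) -
      \int[nu]_y (phi \o minimal_incl hK) y) ^+ 2))) //.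
  apply/funext => N; apply: eq_Rintegral => y _.
  rewrite /F /orbit_avg; congr ((_ * _ - _) ^+ 2).
  by apply: eq_bigr => i _; rewrite /= minimal_incl_iter.
apply/cvgrPdist_le => e e0; have e2 : 0 < e / 2 by rewrite divr_gt0.
have [delta d0 equi] := orbit_avg_equicontinuous cphi e2.
pose O := [set y | mdist z y < delta].
have oO : open O by exact: open_mball.
have mO : measurable (O : set (borel (minimal_space hK))).
  exact: sub_sigma_algebra.
have nuO : (0 < nu O)%E.
  by apply: (open_measure_gt0 nu_inv cg oO) => y; exact: minimal_orbit_hits.
pose beta := fine (nu O).
have nuOE : nu O = beta%:E by rewrite fineK// fin_num_measure.
have b0 : 0 < beta by rewrite -lte_fin -nuOE.
have eb : 0 < (e / 2) ^+ 2 * beta by rewrite mulr_gt0// exprn_gt0.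
move/cvgr0Pnorm_lt : L2 => /(_ _ eb) L2.
near=> N.
have [y Oy yc] : exists2 y, O y & `|orbit_avg phi (minimal_incl hK y) N - c| <= e / 2.
  apply: contrapT => no.
  have : `|\int[nu]_y F N y| < (e / 2) ^+ 2 * beta by near: N.
  apply/negP; rewrite -leNgt (le_trans _ (ler_norm _))//.
  have bF : bounded_measurable (F N : borel (minimal_space hK) -> R).
    have b1 : bounded_measurable ((fun y => orbit_avg phi (minimal_incl hK y) N - c)
        : borel (minimal_space hK) -> R).
      apply: bmeasB; last exact: bmeas_cst.
      apply: bmeasZ; apply: bmeas_sum => i.
      have := bmeas_iter mg (a i.+1) bphi; congr bounded_measurable.
      by apply/funext => y /=; rewrite minimal_incl_iter.
    exact: (bmeasM b1 b1).
  have -> : (e / 2) ^+ 2 * beta = \int[nu]_y ((e / 2) ^+ 2 * \1_O y).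
    rewrite RintegralZl//; last by apply: bmeas_integrable; exact: bmeas_indic.
    by congr (_ * _); rewrite /Rintegral integral_indic// setIT.
  apply: le_Rintegral => //.
  - by apply: bmeas_integrable; apply: bmeasZ; exact: bmeas_indic.
  - exact: bmeas_integrable.
  move=> y _; rewrite indicE; have [yO|yO] := boolP (y \in O).
    have le_ec : e / 2 <= `|orbit_avg phi (minimal_incl hK y) N - c|.
      rewrite leNgt; apply/negP => /ltW le; apply: no; exists y => //.
      by move: yO; rewrite inE.
    rewrite mulr1 /F -[leRHS]real_normK ?num_real//.
    by apply: lerXn2r; rewrite ?nnegrE// ltW.
  by rewrite mulr0 sqr_ge0.
have yz : `|orbit_avg phi (minimal_incl hK z) N - orbit_avg phi (minimal_incl hK y) N|
    <= e / 2.
  have H : forall y' z' : minimal_space hK, mdist y' z' < delta ->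
      `|orbit_avg phi (minimal_incl hK y') N - orbit_avg phi (minimal_incl hK z') N|
      <= e / 2 by near: N.
  exact: H.
rewrite distrC -(subrKA (orbit_avg phi (minimal_incl hK y) N)).
by rewrite (le_trans (ler_normD _ _))//; lra.
Unshelve. all: by end_near. Qed.

(** The orbit of x is compared with that of a point z of K that stays close to
    it on average. At distance less than r uniform continuity of phi applies;
    at distance at least r the trivial bound of the difference is at most the
    distance times a constant. *)
Theorem orbit_avg_basin (phi : X -> R) (x : X) : continuous phi ->
  basin a f K x ->
  orbit_avg phi x @ \oo --> \int[nu]_y phi (minimal_incl hK y).
Proof.
move=> cphi bx; set c := \int[nu]_y _.
apply/cvgrPdist_le => e e0; have e3 : 0 < e / 3 by rewrite divr_gt0.
have [B hB] := compact_fun_bounded cX cphi.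
have [r r0 hr] := compact_fun_uniform cX cphi e3.
pose B' := 2 * `|B| + 1.
have B'0 : 0 < B' by rewrite ltr_wpDl// mulr_ge0.
have s0 : 0 < e / 3 / (B' / r) by rewrite !divr_gt0.
have [z Kz] := bx _ s0.
have [y yz] := minimal_incl_sur hK Kz.
move=> /limn_esup_lt_near near_xz.
have /cvgrPdist_le/(_ _ e3) near_z := orbit_avg_minimal y cphi.
near=> N.
have xz : N%:R^-1 * \sum_(i < N) mdist (iter (a i.+1) f x) (iter (a i.+1) f z)
    < e / 3 / (B' / r).
  rewrite -lte_fin; near: N; move: near_xz; apply: filterS => N.
  by rewrite /Defs.cesaro big_add1/= big_mkord.
have zc : `|c - orbit_avg phi z N| <= e / 3 by rewrite -yz; near: N.
have N0 : (0 < N)%N by near: N; exact: nbhs_infty_gt.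
have N0r : 0 < N%:R :> R by rewrite ltr0n.
have : `|orbit_avg phi z N - orbit_avg phi x N| <= e / 3 + e / 3.
  apply: le_trans (orbit_avg_dist _ _ _ _) _.
  apply: (@le_trans _ _ (e / 3 + B' / r * (N%:R^-1 *
      \sum_(i < N) mdist (iter (a i.+1) f x) (iter (a i.+1) f z)))); last first.
    by rewrite lerD2l mulrC -ler_pdivlMr ?divr_gt0// ltW.
  rewrite [leRHS](_ : _ = N%:R^-1 * \sum_(i < N) (e / 3 + B' / r *
      mdist (iter (a i.+1) f x) (iter (a i.+1) f z))); last first.
    rewrite big_split/= sumr_const card_ord -mulr_sumr -[(e / 3) *+ N]mulr_natl.
    by field; rewrite !gt_eqF.
  rewrite ler_pM2l ?invr_gt0//; apply: ler_sum => i _.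
  set u := iter _ f z; set v := iter _ f x.
  have [uv|ru] := ltP (mdist v u) r.
    rewrite distrC (le_trans (ltW (hr _ _ uv)))// lerDl mulr_ge0 ?mdist_ge0//.
    by rewrite divr_ge0 ?ltW.
  rewrite (le_trans (ler_normB _ _))//.
  have : B' <= B' / r * mdist v u by rewrite mulrAC ler_pdivlMr// ler_pM2l.
  have BB' : 2 * `|B| <= B' by rewrite /B' lerDl.
  have := hB u; have := hB v; have := ler_norm B; set w := B' / r * _; lra.
rewrite -(subrKA (orbit_avg phi z N) c) => xz'.
by rewrite (le_trans (ler_normD _ _))//; lra.
Unshelve. all: by end_near. Qed.

End on_minimal_subset.
End equidistribution.

(** * The inverse squares of the odd integers *)

Section odd_basel.
Context {R : realType}.
Implicit Type x : R.

(** By the mean value theorem sin x = x cos c with 0 < c < x, and cos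
    decreases. *)
Lemma sin_between x : 0 < x < pi / 2 -> x * cos x <= sin x <= x.
Proof.
move=> /andP[x0 x1].
have [c] := @MVT R sin cos 0 x x0 (fun y _ => is_derive_sin y)
  (continuous_subspaceT (@continuous_sin R)).
rewrite in_itv/= => /andP[c0 cx]; rewrite sin0 !subr0 => ->.
have p0 := @pi_gt0 R.
have cc : cos x <= cos c.
  by rewrite ltW// ltr_cos// in_itv/=; apply/andP; split; lra.
by rewrite mulrC ler_pM2r// cc/= ler_piMl ?cos_le1// ltW.
Qed.

(** The upper bound comes from 1 / sin ^+ 2 = (cos / sin) ^+ 2 + 1. *)
Lemma sinV2_between x : 0 < x < pi / 2 ->
  x ^- 2 <= sin x ^- 2 <= x ^- 2 + 1.
Proof.
move=> x01; have /andP[s1 s2] := sin_between x01.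
have s0 := sin_gt0_pihalf x01; have /andP[x0 x1] := x01.
apply/andP; split; first by rewrite lef_pV2 ?posrE ?exprn_gt0// lerXn2r ?nnegrE// ltW.
have -> : sin x ^- 2 = (cos x / sin x) ^+ 2 + 1.
  rewrite expr_div_n -[X in _ + X](@divff _ (sin x ^+ 2)) ?expf_neq0 ?gt_eqF//.
  by rewrite -mulrDl cos2Dsin2 mul1r.
rewrite lerD2r -exprVn lerXn2r// ?nnegrE ?invr_ge0 ?(ltW x0)//.
  by rewrite divr_ge0 ?(ltW s0)// cos_ge0_pihalf//; apply/andP; split; lra.
by rewrite ler_pdivrMr// ler_pdivlMl.
Qed.

Lemma sinV2_half x : 0 < x < pi ->
  sin (x / 2) ^- 2 + sin (pi / 2 - x / 2) ^- 2 = 4 * sin x ^- 2.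
Proof.
move=> /andP[x0 x1]; have xh : 0 < x / 2 < pi / 2 by apply/andP; split; lra.
have s0 := sin_gt0_pihalf xh.
have c0 : 0 < cos (x / 2).
  by apply: cos_gt0_pihalf; have := @pi_gt0 R; move: xh => /andP[? ?]; lra.
have -> : sin (pi / 2 - x / 2) = cos (x / 2) by rewrite addrC sinDpihalf cosN.
have -> : sin x = 2 * (cos (x / 2) * sin (x / 2)).
  have {1}-> : x = x / 2 *+ 2 by rewrite -mulr_natl; field.
  by rewrite sin_mulr2n mulr_natl.
set c := cos _ in c0 *; set s := sin _ in s0 *.
have cs : c ^+ 2 + s ^+ 2 = 1 by exact: cos2Dsin2.
have -> : 4 * (2 * (c * s)) ^- 2 = (c ^+ 2 + s ^+ 2) / (c * s) ^+ 2.
  by rewrite cs; field; rewrite !gt_eqF.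
by field; rewrite !gt_eqF.
Qed.

Let ang (n k : nat) : R := (2 * k + 1)%:R * pi / (4 * 2 ^ n)%:R.

Let ang_bounds n k : (k < 2 ^ n)%N -> 0 < ang n k < pi / 2.
Proof.
move=> kn; have n0 : 0 < (4 * 2 ^ n)%:R :> R by rewrite ltr0n muln_gt0 expn_gt0.
have -> /= : 0 < ang n k by rewrite divr_gt0// mulr_gt0 ?pi_gt0// ltr0n addn1.
rewrite /ang ltr_pdivrMr// [ltRHS](_ : _ = (2 * 2 ^ n)%:R * pi); last first.
  by rewrite !natrM; field.
by rewrite ltr_pM2r ?pi_gt0// ltr_nat; lia.
Qed.

(** The angles of level n.+1 are the halves of those of level n and the
    complements of these halves to pi / 2, so the sum is multiplied by 4 from
    one level to the next. *)
Lemma sum_sinV2 n :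
  \sum_(k < 2 ^ n) sin ((2 * k + 1)%:R * pi / (4 * 2 ^ n)%:R) ^- 2 = 2 * 4 ^+ n :> R.
Proof.
elim: n => [|n IHn].
  rewrite expn0 big_ord1 expr0 muln0 add0n mul1r muln1 mulr1.
  have : cos (pi / 4 + pi / 4 : R) = 0.
    by rewrite -[X in cos X](_ : pi / 2 = _) ?cos_pihalf//; field.
  rewrite cosD -!expr2 => /eqP; rewrite subr_eq0 => /eqP cs.
  have := cos2Dsin2 (pi / 4 : R); rewrite cs => s1.
  have -> : sin (pi / 4) ^+ 2 = 2^-1 :> R by lra.
  by rewrite invrK.
rewrite -[LHS]/(\sum_(k < 2 ^ n.+1) sin (ang n.+1 k) ^- 2).
rewrite -(big_mkord xpredT (fun k => sin (ang n.+1 k) ^- 2)).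
have n2 : (2 ^ n <= 2 ^ n.+1)%N by rewrite leq_exp2l.
rewrite (big_cat_nat _ n2)//= [X in _ + X]big_nat_rev/=.
have -> (F : nat -> R) : \sum_(2 ^ n <= k < 2 ^ n.+1) F k =
    \sum_(0 <= k < 2 ^ n) F (k + 2 ^ n)%N.
  rewrite -{1}(add0n (2 ^ n)%N) big_addn; congr (\sum_(_ <= _ < _) _).
  by rewrite expnS; lia.
rewrite -big_split/= big_mkord.
rewrite exprS mulrCA -IHn mulr_sumr; apply: eq_bigr => k _.
have kn := ltn_ord k; have /andP[a0 a1] := ang_bounds kn.
rewrite -[(2 * k + 1)%:R * pi / _]/(ang n k) -sinV2_half; last first.
  by have p0 := @pi_gt0 R; apply/andP; split; lra.
have N0 : (2 ^ n)%:R != 0 :> R by rewrite pnatr_eq0 expn_eq0.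
congr (sin _ ^- 2 + sin _ ^- 2).
  by rewrite /ang expnS !natrM; field.
rewrite /ang (_ : 2 ^ n + 2 ^ n.+1 - (k + 2 ^ n).+1 = 2 ^ n.+1 - k.+1)%N; last by lia.
rewrite natrD natrM natrB; last by rewrite (leq_trans kn).
by rewrite expnS !natrM -natr1 natrD natrM; field.
Qed.

(** Replacing sin by its argument in the sum of level n changes the sum by at
    most 1 per term, hence by 2 ^ n, whereas the whole sum is 2 * 4 ^ n. *)
Lemma sum_odd_squares n :
  (pi : R) ^+ 2 / 8 - (pi : R) ^+ 2 / 16 / 2 ^+ n <=
    \sum_(k < 2 ^ n) (2 * k + 1)%:R ^- 2 <= (pi : R) ^+ 2 / 8.
Proof.
set S := \sum_(k < _) _.
(* P is pi with its definition, the double of a zero of cos, kept folded. *)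
have [P PE] : exists P : R, P = pi by exists pi.
have p0 : P != 0 by rewrite PE gt_eqF ?pi_gt0.
have pp : 0 < P ^+ 2 by rewrite exprn_gt0// PE pi_gt0.
have t0 : 0 < 2 ^+ n :> R by rewrite exprn_gt0.
have E : \sum_(k < 2 ^ n) ang n k ^- 2 = 16 * (2 ^+ n) ^+ 2 / P ^+ 2 * S.
  rewrite mulr_sumr; apply: eq_bigr => k _; rewrite /ang -PE natrM natrX.
  by field; rewrite p0 (gt_eqF t0) -natrM natr1 pnatr_eq0.
have F : 4 ^+ n = (2 ^+ n) ^+ 2 :> R by rewrite exprAC; congr (_ ^+ _); lra.
rewrite -PE.
have up : \sum_(k < 2 ^ n) ang n k ^- 2 <= 2 * 4 ^+ n.
  rewrite -sum_sinV2; apply: ler_sum => k _.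
  by have /andP[] := sinV2_between (ang_bounds (ltn_ord k)).
have lo : 2 * 4 ^+ n <= \sum_(k < 2 ^ n) ang n k ^- 2 + 2 ^+ n.
  rewrite -sum_sinV2 -[X in _ + X]natrX -[X in _ + X%:R](card_ord (2 ^ n)) -sumr_const.
  rewrite -big_split; apply: ler_sum => k _.
  by have /andP[] := sinV2_between (ang_bounds (ltn_ord k)).
rewrite E F in up lo; set t := 2 ^+ n in t0 up lo *.
have q0 : 0 < P ^+ 2 / (16 * t ^+ 2) by rewrite divr_gt0// mulr_gt0// exprn_gt0.
apply/andP; split.
  have -> : S = 16 * t ^+ 2 / P ^+ 2 * S * (P ^+ 2 / (16 * t ^+ 2)).
    by field; rewrite ?p0 ?(gt_eqF t0).
  have -> : P ^+ 2 / 8 - P ^+ 2 / 16 / t =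
      (2 * t ^+ 2 - t) * (P ^+ 2 / (16 * t ^+ 2)) by field; rewrite gt_eqF.
  by rewrite ler_pM2r// lerBlDr.
have -> : S = 16 * t ^+ 2 / P ^+ 2 * S * (P ^+ 2 / (16 * t ^+ 2)).
  by field; rewrite ?p0 ?(gt_eqF t0).
have -> : P ^+ 2 / 8 = 2 * t ^+ 2 * (P ^+ 2 / (16 * t ^+ 2)).
  by field; rewrite gt_eqF.
by rewrite ler_pM2r.
Qed.

End odd_basel.

(** * Sieving by prime powers *)

(** The sieve with e = 1 leads to the Euler product of the sum of the inverse
    squares; the one with e = 2 approaches the square-free numbers. *)
Definition sieved (e y n : nat) : bool :=
  all (fun p => ~~ (prime p && (p ^ e %| n)%N)) (iota 0 y).

Lemma sievedS e y n :
  sieved e y.+1 n = sieved e y n && ~~ (prime y && (y ^ e %| n)%N).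
Proof. by rewrite /sieved -addn1 iotaD all_cat/= andbT. Qed.

Lemma sievedM e y m : prime y -> sieved e y (y ^ e * m) = sieved e y m.
Proof.
move=> py; apply: eq_in_all => p; rewrite mem_iota/= => pny.
case: (boolP (prime p)) => //= pp; rewrite Gauss_dvdr//.
rewrite coprimeXl// coprimeXr// prime_coprime// dvdn_prime2//.
by rewrite neq_ltn pny.
Qed.

Section sieve_sums.
Context {R : realType}.
Implicit Type w : nat -> R.

Lemma sum_multiples (d N : nat) w : (0 < d)%N ->
  \sum_(1 <= n < N.+1 | (d %| n)%N) w n =
  \sum_(1 <= m < (N %/ d).+1) w (d * m)%N.
Proof.
move=> d0; elim: N => [|N IHN]; first by rewrite div0n !big_geq.
rewrite big_mkcond big_nat_recr//= -big_mkcond IHN divnS//.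
case: (boolP (d %| N.+1)%N) => dN; last by rewrite addr0.
rewrite add1n [RHS]big_nat_recr//=; congr (_ + w _).
by rewrite -{1}(divnK dN) mulnC divnS// dN.
Qed.

Definition sifted_sum (e y : nat) w (N : nat) : R :=
  \sum_(1 <= n < N.+1 | sieved e y n) w n.

(** The integers removed by one more prime y are the y ^ e * m, and y ^ e * m
    passes the earlier sieve exactly when m does, y being coprime to the
    smaller primes. *)
Lemma sifted_sumS_prime e y w N : prime y ->
  sifted_sum e y.+1 w N =
  sifted_sum e y w N - sifted_sum e y (fun m => w (y ^ e * m)%N) (N %/ y ^ e).
Proof.
move=> py; apply/eqP; rewrite eq_sym subr_eq; apply/eqP.
have ye0 : (0 < y ^ e)%N by rewrite expn_gt0 prime_gt0.
rewrite /sifted_sum (bigID (fun n => y ^ e %| n)%N)/= addrC; congr (_ + _).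
  by apply: eq_bigl => n; rewrite sievedS py.
transitivity (\sum_(1 <= n < N.+1 | (y ^ e %| n)%N)
    (if sieved e y (n %/ y ^ e) then w n else 0)).
  rewrite -big_mkcondr; apply: eq_bigl => n; rewrite andbC.
  case: (boolP (y ^ e %| n)%N) => //= /dvdnP[m ->].
  by rewrite mulnK// mulnC sievedM.
rewrite sum_multiples// [RHS]big_mkcond; apply: eq_bigr => m _.
by rewrite mulKn.
Qed.

Lemma sifted_sumS_nonprime e y w N : ~~ prime y ->
  sifted_sum e y.+1 w N = sifted_sum e y w N.
Proof. by move=> /negPf ny; apply: eq_bigl => n; rewrite sievedS ny andbT. Qed.

Definition euler_product (y : nat) : R :=
  \prod_(0 <= p < y | prime p) (1 - p%:R ^- 2).

Lemma euler_productS y : euler_product y.+1 =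
  euler_product y * (if prime y then 1 - y%:R ^- 2 else 1).
Proof. by rewrite /euler_product big_mkcond big_nat_recr//= -big_mkcond. Qed.

Lemma cvg_divn (d : nat) : (0 < d)%N -> (fun N => N %/ d)%N @ \oo --> \oo.
Proof.
move=> d0 A [m _ mA]; exists (m * d)%N => // N /= mN; apply: mA => /=.
by rewrite leq_divRL.
Qed.

Lemma cvg_divn_ratio (d : nat) : (0 < d)%N ->
  (fun N => (N %/ d)%:R / N%:R : R) @ \oo --> (d%:R^-1 : R).
Proof.
move=> d0; have d0r : 0 < d%:R :> R by rewrite ltr0n.
apply/cvgrPdist_lt => e e0.
move/cvgr0Pnorm_lt : (@cvg_invn R) => /(_ _ e0) ne.
near=> N; have N0 : 0 < N%:R :> R by rewrite ltr0n; near: N; exact: nbhs_infty_gt.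
have : `|N%:R^-1| < e :> R by near: N.
apply: le_lt_trans; rewrite [leRHS]ger0_norm ?invr_ge0//.
have E : N%:R = (N %/ d)%:R * d%:R + (N %% d)%:R :> R.
  by rewrite -natrM -natrD -divn_eq.
have -> : d%:R^-1 - (N %/ d)%:R / N%:R = (N %% d)%:R / d%:R / N%:R :> R.
  rewrite [in RHS](_ : (N %% d)%:R = N%:R - (N %/ d)%:R * d%:R); last by rewrite E; ring.
  by field; rewrite !gt_eqF.
rewrite ger0_norm ?divr_ge0 ?divr_ge0//; rewrite ler_piMl ?invr_ge0//.
by rewrite ler_pdivrMr// mul1r ler_nat ltnW// ltn_mod.
Unshelve. all: by end_near. Qed.

Lemma sum_invsquares_tail (y N : nat) : (1 < y)%N ->
  \sum_(y <= n < N.+1) n%:R ^- 2 <= (y.-1)%:R^-1 :> R.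
Proof.
move=> y1; have [yN|Ny] := leqP y N.+1; last first.
  by rewrite big_geq ?invr_ge0// ltnW.
suff H : \sum_(y <= n < N.+1) n%:R ^- 2 <= (y.-1)%:R^-1 - N%:R^-1 :> R.
  by apply: le_trans H _; rewrite gerBl invr_ge0.
have -> : (y.-1)%:R^-1 - N%:R^-1 = \sum_(y <= n < N.+1) ((n.-1)%:R^-1 - n%:R^-1) :> R.
  have := telescope_sumr (fun n => - (n.-1)%:R^-1 : R) yN.
  by rewrite /= opprK addrC => <-; apply: eq_bigr => n _; rewrite /= opprK addrC.
rewrite big_nat [leRHS]big_nat; apply: ler_sum => n /andP[yn _].
case: n yn => [|n] yn; first by rewrite leqn0 in yn; rewrite (eqP yn) in y1.
have n0 : 0 < n%:R :> R by rewrite ltr0n; lia.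
rewrite /= -natr1.
have -> : n%:R^-1 - (n%:R + 1)^-1 = (n%:R * (n%:R + 1))^-1 :> R.
  by field; rewrite !gt_eqF// addr_gt0.
rewrite lef_pV2 ?posrE ?mulr_gt0 ?exprn_gt0 ?addr_gt0//.
by rewrite expr2 ler_pM2r ?addr_gt0// lerDl.
Qed.

(** Every integer above 1 that passes the sieve is at least y, as is each of
    its prime factors. *)
Lemma sifted_invsquares_bounds y N : (1 < y)%N -> (0 < N)%N ->
  1 <= sifted_sum 1 y (fun n => n%:R ^- 2) N <= 1 + (y.-1)%:R^-1.
Proof.
move=> y1 N0; rewrite /sifted_sum big_mkcond big_ltn ?ltnS//.
have -> : sieved 1 y 1.
  apply/allP => p _; rewrite expn1 dvdn1; case: eqP => [->|_]; last by rewrite andbF.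
  by [].
rewrite expr1n invr1 lerDl sumr_ge0/=; last by move=> n _; case: ifP.
rewrite lerD2l; apply: le_trans (sum_invsquares_tail N y1).
have [yN|Ny] := leqP y N.+1.
  rewrite (big_cat_nat _ yN)//= big_nat big1 ?add0r.
    by apply: ler_sum => n _; case: ifP.
  move=> n /andP[n1 ny]; case: ifP => // /allP/(_ (pdiv n)).
  rewrite mem_iota/= (leq_ltn_trans (pdiv_leq _) ny) ?(ltnW n1)//.
  by rewrite expn1 pdiv_dvd pdiv_prime//= => /(_ isT).
rewrite [leRHS]big_geq ?(ltnW Ny)// big_nat big1// => n /andP[n1 nN].
have ny := ltn_trans nN Ny.
case: ifP => // /allP/(_ (pdiv n)).
rewrite mem_iota/= (leq_ltn_trans (pdiv_leq _) ny) ?(ltnW n1)//.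
by rewrite expn1 pdiv_dvd pdiv_prime//= => /(_ isT).
Qed.

Lemma sifted_odd_cvg :
  sifted_sum 1 3 (fun n => n%:R ^- 2) @ \oo --> (pi ^+ 2 / 8 : R).
Proof.
have odds n : sieved 1 3 n = odd n.
  by rewrite /sieved/= expn1 dvdn2 negbK andbT.
have E M : sifted_sum 1 3 (fun n => n%:R ^- 2) (2 * M) =
    \sum_(k < M) (2 * k + 1)%:R ^- 2 :> R.
  rewrite /sifted_sum; under eq_bigl do rewrite odds.
  elim: M => [|M IHM]; first by rewrite muln0 big_geq// big_ord0.
  rewrite big_ord_recr/= -IHM (_ : 2 * M.+1 = (2 * M).+2)%N; last by lia.
  rewrite big_mkcond big_nat_recr//= big_nat_recr//= -big_mkcond.
  by rewrite mul2n/= odd_double/= addr0 addn1.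
have mono N M : (N <= M)%N -> sifted_sum 1 3 (fun n => n%:R ^- 2) N <=
    sifted_sum 1 3 (fun n => n%:R ^- 2) M :> R.
  move=> NM; rewrite /sifted_sum big_mkcond [leRHS]big_mkcond/=.
  rewrite [leRHS](@big_cat_nat _ _ _ N.+1)//= lerDl sumr_ge0// => n _.
  by case: ifP.
apply/cvgrPdist_le => e e0.
have c0 : 0 < pi ^+ 2 / 16 :> R by rewrite divr_gt0// exprn_gt0// pi_gt0.
have ec : 0 < e / (pi ^+ 2 / 16) by rewrite divr_gt0.
have half01 : `|2^-1 : R| < 1 by rewrite ger0_norm; lra.
have /cvgr0Pnorm_lt/(_ _ ec)[n _ /(_ n (leqnn n))] := cvg_expr half01.
rewrite /= ger0_norm ?exprn_ge0// exprVn ltr_pdivlMr// mulrC => nc.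
exists (2 * 2 ^ n)%N => // N /= nN.
have := mono _ _ nN; rewrite E => lo.
have := mono N (2 * 2 ^ N)%N.
have N2 : (N <= 2 * 2 ^ N)%N.
  by rewrite -expnS ltnW// (ltn_trans (ltnSn N))// ltn_expl.
rewrite E => /(_ N2) up.
have /andP[l1 _] := @sum_odd_squares R n.
have /andP[_ u1] := @sum_odd_squares R N.
have u2 := le_trans up u1; have l2 := le_trans l1 lo.
rewrite ger0_norm ?subr_ge0//; lra.
Qed.

(** Each prime y subtracts y ^- 2 times the same sum up to N / y, that is, it
    multiplies the limit by 1 - y ^- 2. The induction starts from the odd
    integers at y = 3, where the product is 3 / 4. *)
Lemma euler_product_mass y : (2 < y)%N ->
  sifted_sum 1 y (fun n => n%:R ^- 2) @ \oo --> pi ^+ 2 / 6 * euler_product y.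
Proof.
elim: y => // y IHy; rewrite ltnS leq_eqVlt => /predU1P[<-|y2].
  have -> : pi ^+ 2 / 6 * euler_product 3 = pi ^+ 2 / 8 :> R.
    by rewrite /euler_product unlock/=; field.
  exact: sifted_odd_cvg.
have {}IHy := IHy y2; have y0 : (0 < y)%N by lia.
rewrite euler_productS; have [py|npy] := boolP (prime y); last first.
  rewrite mulr1; under eq_cvg do rewrite sifted_sumS_nonprime//; exact: IHy.
under eq_cvg do rewrite sifted_sumS_prime//.
rewrite mulrBr mulr1 mulrBr; apply: cvgB; first exact: IHy.
rewrite [X in _ --> X](_ : _ = y%:R ^- 2 * (pi ^+ 2 / 6 * euler_product y)); last first.
  by rewrite mulrA mulrC.
rewrite (_ : (fun N => _) = fun N => y%:R ^- 2 *
    sifted_sum 1 y (fun n => n%:R ^- 2) (N %/ y)); last first.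
  apply/funext => N; rewrite /sifted_sum expn1 mulr_sumr.
  by apply: eq_bigr => n _; rewrite natrM exprMn invfM.
apply: cvgM; first exact: cvg_cst.
exact: cvg_comp (cvg_divn y0) IHy.
Qed.

(** As y grows, the sieved sum reduces to its first term, which is 1. *)
Theorem euler_product_cvg : euler_product @ \oo --> (6 / pi ^+ 2 : R).
Proof.
(* P is pi with its definition, the double of a zero of cos, kept folded. *)
have [P PE] : exists P : R, P = pi by exists pi.
have P0 : P != 0 by rewrite PE gt_eqF ?pi_gt0.
have bnd y : (2 < y)%N -> `|1 - pi ^+ 2 / 6 * euler_product y| <= (y.-1)%:R^-1.
  move=> y2; have cv := euler_product_mass y2; have y1 : (1 < y)%N by lia.
  rewrite -(cvg_lim _ cv)// distrC ler_norml.
  have lo : 1 <= limn (sifted_sum 1 y (fun n => n%:R ^- 2)) :> R.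
    apply: limr_ge; first exact: cvgP cv.
    near=> N; have N0 : (0 < N)%N by near: N; exact: nbhs_infty_gt.
    by have /andP[] := sifted_invsquares_bounds y1 N0.
  have up : limn (sifted_sum 1 y (fun n => n%:R ^- 2)) <= 1 + (y.-1)%:R^-1 :> R.
    apply: limr_le; first exact: cvgP cv.
    near=> N; have N0 : (0 < N)%N by near: N; exact: nbhs_infty_gt.
    by have /andP[] := sifted_invsquares_bounds y1 N0.
  have : 0 <= (y.-1)%:R^-1 :> R by rewrite invr_ge0.
  by move: lo up; set l := limn _; set q := _^-1 => *; apply/andP; split; lra.
have : (fun y => pi ^+ 2 / 6 * euler_product y) @ \oo --> (1 : R).
  apply/cvgrPdist_le => e e0.
  move/cvgr0Pnorm_le : (@cvg_invn R) => /(_ _ e0)[M _ MP].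
  exists (maxn M.+1 3) => // y /=; rewrite geq_max => /andP[My y3].
  apply: le_trans (bnd y y3) (le_trans (ler_norm _) (MP _ _)) => /=.
  lia.
rewrite -PE => cv.
have : (fun y => 6 / P ^+ 2 * (P ^+ 2 / 6 * euler_product y)) @ \oo
    --> 6 / P ^+ 2 * (1 : R).
  by apply: cvgM => //; exact: cvg_cst.
rewrite mulr1 (_ : (fun y => _) = euler_product)//.
by apply/funext => y; field.
Unshelve. all: by end_near. Qed.

End sieve_sums.

(** * Averages over square-free integers *)

Lemma squarefree_sieved (y n : nat) : squarefree n -> sieved 2 y n.
Proof.
move=> /andP[n0 /allP sq]; apply/allP => p _; apply/negP => /andP[pp pn].
have : p \in primes n.
  by rewrite mem_primes pp n0 (dvdn_trans _ pn)// expnS dvdn_mulr.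
by move=> /sq; rewrite pn.
Qed.

Lemma nonsquarefree_divisor (y n : nat) : (0 < n)%N -> sieved 2 y n ->
  ~~ squarefree n -> exists2 p, (y <= p <= n)%N & (p ^ 2 %| n)%N.
Proof.
move=> n0 sv; rewrite /squarefree n0/= -has_predC => /hasP[p].
rewrite mem_primes n0/= negbK => /andP[pp pn] p2n; exists p => //.
rewrite (dvdn_leq n0 pn) andbT leqNgt; apply/negP => py.
have /allP/(_ p) := sv; rewrite mem_iota/= py => /(_ isT).
by rewrite pp p2n.
Qed.

(** An integer that passes the sieve without being square-free is divisible by
    d ^ 2 for some d >= y, and at most N / d ^ 2 integers up to N are. *)
Lemma squarefree_sum_approx (R : realType) (w : nat -> R) (B : R) (y N : nat) :
  (forall n, `|w n| <= B) -> (1 < y)%N ->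
  `|\sum_(1 <= n < N.+1 | squarefree n) w n - sifted_sum 2 y w N|
    <= B * N%:R / (y.-1)%:R.
Proof.
move=> wB y1; have B0 : 0 <= B := le_trans (normr_ge0 _) (wB 0%N).
have -> : \sum_(1 <= n < N.+1 | squarefree n) w n - sifted_sum 2 y w N =
    - \sum_(1 <= n < N.+1 | sieved 2 y n && ~~ squarefree n) w n.
  rewrite /sifted_sum [X in _ - X](bigID squarefree)/= opprD addrA.
  rewrite -[RHS]add0r; congr (_ - _); apply/eqP; rewrite subr_eq0; apply/eqP.
  apply: eq_bigl => n; case: (boolP (squarefree n)) => [/squarefree_sieved->//|_].
  by rewrite andbF.
rewrite normrN (le_trans (ler_norm_sum _ _ _))//.
apply: (@le_trans _ _ (\sum_(1 <= n < N.+1) B * \sum_(y <= d < N.+1)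
    ((d ^ 2 %| n)%N : nat)%:R)).
  rewrite big_mkcond big_nat [leRHS]big_nat; apply: ler_sum => n /andP[n1 nN].
  case: ifP => [/andP[sv nsq]|_]; last by rewrite mulr_ge0// sumr_ge0.
  apply: le_trans (wB n) _; rewrite ler_peMr//.
  have [p /andP[yp pn] p2] := nonsquarefree_divisor n1 sv nsq.
  rewrite (bigD1_seq p)/= ?iota_uniq//; last first.
    by rewrite mem_index_iota yp (leq_ltn_trans pn).
  by rewrite p2 lerDl sumr_ge0.
rewrite -mulr_sumr -mulrA ler_wpM2l// exchange_big/=.
apply: (@le_trans _ _ (\sum_(y <= d < N.+1) N%:R * d%:R ^- 2)); last first.
  by rewrite -mulr_sumr ler_wpM2l// sum_invsquares_tail.
rewrite big_nat [leRHS]big_nat; apply: ler_sum => d /andP[yd _].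
have d0 : (0 < d)%N by lia.
rewrite (eq_bigr (fun n => if (d ^ 2 %| n)%N then 1 else 0)) => [|n _]; last by case: ifP.
rewrite -big_mkcond sum_multiples ?expn_gt0 ?d0// sumr_const_nat subn1/=.
rewrite ler_pdivlMr ?exprn_gt0 ?ltr0n// -natrX -natrM ler_nat.
exact: leq_trunc_div.
Qed.

Section squarefree_average.
Context {R : realType} (a : nat -> nat) (v : nat -> R) (B l : R).
Hypothesis a_add : completely_additive a.
Hypothesis vB : forall n, `|v n| <= B.
Hypothesis v_avg : forall j,
  (fun N => N%:R^-1 * \sum_(1 <= n < N.+1) v (a n + j)%N) @ \oo --> l.

(** By complete additivity, passing from m to y ^ 2 * m shifts the time a m by
    a (y ^ 2); hence the induction on y runs over all shifts j at once. *)
Lemma sifted_average_cvg y j :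
  (fun N => N%:R^-1 * sifted_sum 2 y (fun n => v (a n + j)%N) N) @ \oo
    --> l * euler_product y.
Proof.
elim: y j => [|y IHy] j.
  rewrite /euler_product big_geq// mulr1; exact: v_avg.
rewrite euler_productS; have [py|npy] := boolP (prime y); last first.
  by rewrite mulr1; under eq_cvg do rewrite sifted_sumS_nonprime//; exact: IHy.
have y0 : (0 < y ^ 2)%N by rewrite expn_gt0 prime_gt0.
under eq_cvg do rewrite sifted_sumS_prime// mulrBr.
rewrite mulrBr mulr1 mulrBr; apply: cvgB; first exact: IHy.
have -> : l * (euler_product y / y%:R ^+ 2) =
    (y ^ 2)%:R^-1 * (l * euler_product y) by rewrite natrX mulrA mulrC.
have H : (fun N => (N %/ y ^ 2)%:R / N%:R * ((N %/ y ^ 2)%:R^-1 *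
    sifted_sum 2 y (fun n => v (a n + (a (y ^ 2) + j))%N) (N %/ y ^ 2))) @ \oo -->
    (y ^ 2)%:R^-1 * (l * euler_product y).
  apply: cvgM (@cvg_divn_ratio R _ y0) _.
  exact: cvg_comp (cvg_divn y0) (IHy (a (y ^ 2) + j)%N).
apply: cvg_trans H; apply: near_eq_cvg; near=> N.
have N1 : (0 < N %/ y ^ 2)%N by rewrite divn_gt0//; near: N; exact: nbhs_infty_ge.
have Nr : N%:R != 0 :> R by rewrite pnatr_eq0; case: (N) N1; rewrite ?div0n.
have N1r : (N %/ y ^ 2)%:R != 0 :> R by rewrite pnatr_eq0 -lt0n.
rewrite /sifted_sum [in RHS]big_nat_cond [in LHS]big_nat_cond.
set S := \sum_(_ <= _ < _ | _) _; set S' := \sum_(_ <= _ < _ | _) _.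
have -> : S = S'.
  apply: eq_bigr => n /andP[/andP[n1 _] _].
  by congr (v _); rewrite (a_add y0 n1); lia.
by move: (_ %/ _)%:R N1r => q q0; field; rewrite Nr q0.
Unshelve. all: by end_near. Qed.

(** The sieve by the primes below y misses the square-free sum by at most a
    multiple of N / (y - 1), uniformly in N, so y may be chosen before N tends
    to infinity. *)
Theorem squarefree_average_cvg :
  (fun N => N%:R^-1 * \sum_(1 <= n < N.+1 | squarefree n) v (a n)) @ \oo
    --> 6 / pi ^+ 2 * l.
Proof.
have B0 : 0 <= B := le_trans (normr_ge0 _) (vB 0%N).
apply/cvgrPdist_lt => e e0; have e4 : 0 < e / 4 by rewrite divr_gt0.
have eB : 0 < e / 4 / (B + 1) by rewrite divr_gt0// ltr_wpDl.
have : (fun y => l * euler_product y) @ \oo --> l * (6 / pi ^+ 2).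
  by apply: cvgM; [exact: cvg_cst|exact: euler_product_cvg].
move=> /cvgrPdist_lt/(_ _ e4)[y1 _ hy1].
move/cvgr0Pnorm_lt : (@cvg_invn R) => /(_ _ eB)[y2 _ hy2].
pose y := (maxn y1 y2).+2.
have ly : `|l * (6 / pi ^+ 2) - l * euler_product y| < e / 4.
  by apply: hy1 => /=; rewrite /y; lia.
have By : B / (y.-1)%:R <= e / 4.
  have := hy2 (maxn y1 y2).+1; rewrite /= => /(_ _)H.
  have {H} : `|(maxn y1 y2).+1%:R^-1| < e / 4 / (B + 1) :> R by apply: H; lia.
  rewrite ger0_norm ?invr_ge0// ltr_pdivlMr ?ltr_wpDl// => H.
  apply: ltW; apply: le_lt_trans H.
  by rewrite mulrC ler_wpM2l ?invr_ge0// lerDl.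
have /cvgrPdist_lt/(_ _ e4) hN := @sifted_average_cvg y 0.
near=> N; have N0 : 0 < N%:R :> R by rewrite ltr0n; near: N; exact: nbhs_infty_gt.
have sN : `|l * euler_product y -
    N%:R^-1 * sifted_sum 2 y (fun n => v (a n + 0)%N) N| < e / 4 by near: N.
have dN := @squarefree_sum_approx R (fun n => v (a n)) B y N (fun n => vB _) isT.
have E : sifted_sum 2 y (fun n => v (a n + 0)%N) N = sifted_sum 2 y (fun n => v (a n)) N.
  by apply: eq_bigr => n _; rewrite addn0.
rewrite {}E in sN.
set S := \sum_(_ <= _ < _ | _) _ in dN *; set S' := sifted_sum _ _ _ _ in sN dN.
have {}dN : `|N%:R^-1 * S - N%:R^-1 * S'| <= e / 4.
  rewrite -mulrBr normrM ger0_norm ?invr_ge0// ler_pdivrMl//.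
  apply: le_trans dN _; rewrite mulrAC mulrC ler_pM2l//.
rewrite mulrC; move: ly sN dN; rewrite !ltr_norml !ler_norml.
set p := l * _; set q := l * _; set r := _ * S; set s := _ * S'.
by move=> /andP[? ?] /andP[? ?] /andP[? ?]; apply/andP; split; lra.
Unshelve. all: by end_near. Qed.

End squarefree_average.

(** * Complex observables *)

Section complex_parts.
Context {R : realType}.
Implicit Type z : R[i].

Lemma norm_Im_le z : (`|complex.Im z|)%:C <= `|z|.
Proof.
rewrite normc_def lecR -sqrtr_sqr ler_wsqrtr//.
by rewrite lerDr sqr_ge0.
Qed.

Lemma norm_le_parts z : `|z| <= (`|complex.Re z| + `|complex.Im z|)%:C.
Proof.
rewrite normc_def lecR -[leRHS]ger0_norm ?addr_ge0// -sqrtr_sqr ler_wsqrtr//.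
rewrite sqrrD !real_normK ?num_real// lerD2r lerDl.
by rewrite mulrn_wge0// mulr_ge0.
Qed.

Lemma continuous_part (T : topologicalType) (p : R[i] -> R) (phi : T -> R[i]^o) :
  (forall z w, p (z - w) = p z - p w) -> (forall z, (`|p z|)%:C <= `|z|) ->
  continuous phi -> continuous (p \o phi).
Proof.
move=> pB pn cphi x; apply/cvgrPdist_lt => e e0.
have eC : 0 < e%:C :> R[i] by rewrite ltcR.
have /cvgrPdist_lt/(_ _ eC) := cphi x; apply: filterS => y /= xy.
by rewrite -pB -ltcR (le_lt_trans (pn _)).
Qed.

Lemma cvg_complex (u v : nat -> R) (a b : R) :
  u @ \oo --> a -> v @ \oo --> b ->
  (fun N => (u N +i* v N) : R[i]^o) @ \oo --> ((a +i* b) : R[i]^o).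
Proof.
move=> ua vb; apply/cvgrPdist_lt => e e0.
have [e' e'0 ee] : exists2 e', 0 < e' & e = e'%:C.
  exists (complex.Re e); first by move: e0; rewrite ltcE/= => /andP[].
  by apply/eqP; rewrite eq_complex/= eqxx/=; move: e0; rewrite ltcE/= => /andP[].
have e2 : 0 < e' / 2 by rewrite divr_gt0.
move/cvgrPdist_lt : ua => /(_ _ e2) ua; move/cvgrPdist_lt : vb => /(_ _ e2) vb.
near=> N; rewrite ee (le_lt_trans (norm_le_parts _))// ltcR/=.
have : `|a - u N| < e' / 2 by near: N.
have : `|b - v N| < e' / 2 by near: N.
lra.
Unshelve. all: by end_near. Qed.

Lemma complex_average (P : pred nat) (u v : nat -> R) (N : nat) :
  N%:R^-1 * \sum_(1 <= n < N.+1 | P n) (u n +i* v n) =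
  (N%:R^-1 * \sum_(1 <= n < N.+1 | P n) u n) +i*
  (N%:R^-1 * \sum_(1 <= n < N.+1 | P n) v n).
Proof.
have -> : N%:R^-1 = (N%:R^-1)%:C :> R[i] by rewrite fmorphV/= rmorph_nat.
have -> : \sum_(1 <= n < N.+1 | P n) (u n +i* v n) =
    (\sum_(1 <= n < N.+1 | P n) u n) +i* (\sum_(1 <= n < N.+1 | P n) v n).
  by elim/big_ind3: _ => // x1 x2 x3 y1 y2 y3 -> ->.
by apply/eqP; rewrite eq_complex/= !mul0r subr0 addr0 !eqxx.
Qed.

End complex_parts.

Lemma mobius_sqr n : (mobius n) ^+ 2 = (squarefree n)%:R.
Proof. by rewrite /mobius; case: ifP => _; rewrite ?expr0n// sqrr_sign. Qed.

(** The shifts by j required by the sieve are absorbed into the observable: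
    they replace phi by its composite with the j-th iterate of f, which has the
    same integral. *)
Lemma squarefree_orbit_average (R : realType) (X : metricType R) (f : X -> X)
    (a : nat -> nat) (phi : X -> R) (K : set X) (hK : minimal_subset f K)
    (x : X) (nu : probability (borel (minimal_space hK)) R) :
  compact [set: X] -> continuous f ->
  uniformly_behaved R a -> completely_additive a -> MUEMLS a f ->
  continuous phi -> basin a f K x ->
  invariant_measure (minimal_restr hK) nu ->
  (fun N => N%:R^-1 * \sum_(1 <= n < N.+1 | squarefree n) phi (iter (a n) f x))
    @ \oo --> 6 / pi ^+ 2 * \int[nu]_y phi (minimal_incl hK y).
Proof.
move=> cX cf ub a_add mu_a cphi bx nu_inv; have [ue mls] := mu_a K hK.
have [B hB] := compact_fun_bounded cX cphi.
apply: (@squarefree_average_cvg R a (fun n => phi (iter n f x)) B _ a_add) => // j.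
have cj : continuous (fun y => phi (iter j f y)).
  have ci : continuous (iter j f).
    elim: j => [|j IHj] y; first exact: cvg_id.
    by apply: (@continuous_comp _ _ _ (iter j f) f); [exact: IHj|exact: cf].
  by move=> y; apply: (@continuous_comp _ _ _ (iter j f) phi); [exact: ci|exact: cphi].
have := orbit_avg_basin cX cf ub mls nu_inv ue cj bx.
have -> : \int[nu]_y phi (iter j f (minimal_incl hK y)) =
    \int[nu]_y phi (minimal_incl hK y).
  have mg := continuous_borel_map (@continuous_minimal_restr _ _ _ _ hK cf).
  rewrite -[RHS](Rintegral_iter mg nu_inv j (bmeas_minimal cX hK cphi)).
  by apply: eq_Rintegral => y _ /=; rewrite minimal_incl_iter.
rewrite (_ : orbit_avg _ _ _ _ = fun N => N%:R^-1 *
    \sum_(1 <= n < N.+1) phi (iter (a n + j) f x))//.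
apply/funext => N; rewrite /orbit_avg big_add1/= big_mkord; congr (_ * _).
by apply: eq_bigr => i _; rewrite addnC iterD.
Qed.

Theorem corollary5 (R : realType) (X : metricType R) (f : X -> X)
    (a : nat -> nat) :
  compact [set: X] -> continuous f ->
  uniformly_behaved R a -> completely_additive a ->
  MMA a f -> MUEMLS a f ->
  forall (phi : X -> R[i]^o), continuous phi ->
  forall (K : set X) (hK : minimal_subset f K) (x : X), basin a f K x ->
  forall nu : probability (borel (minimal_space hK)) R,
    invariant_measure (minimal_restr hK) nu ->
  let L : R[i]^o :=
    (6 / pi ^+ 2)%:C * cintegral nu (fun y => phi (minimal_incl hK y)) in
  (fun N : nat => N%:R^-1 * \sum_(1 <= n < N.+1)
      ((mobius n) ^+ 2)%:~R * phi (iter (a n) f x) : R[i]^o) @ \oo --> L /\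
  (fun N : nat => N%:R^-1 * \sum_(1 <= n < N.+1 | squarefree n)
      phi (iter (a n) f x) : R[i]^o) @ \oo --> L.
Proof.
move=> cX cf ub a_add _ mu_a phi cphi K hK x bx nu nu_inv L.
have cRe : continuous (fun y => complex.Re (phi y)).
  apply: (@continuous_part R X (@complex.Re R) phi) => //; last exact: normc_ge_Re.
  by move=> [? ?] [? ?].
have cIm : continuous (fun y => complex.Im (phi y)).
  apply: (@continuous_part R X (@complex.Im R) phi) => //; last exact: norm_Im_le.
  by move=> [? ?] [? ?].
have sq : (fun N : nat => N%:R^-1 * \sum_(1 <= n < N.+1 | squarefree n)
    phi (iter (a n) f x) : R[i]^o) @ \oo --> L.
  have -> : L = (6 / pi ^+ 2 * \int[nu]_y complex.Re (phi (minimal_incl hK y))) +i*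
      (6 / pi ^+ 2 * \int[nu]_y complex.Im (phi (minimal_incl hK y))).
    by rewrite /L /cintegral; apply/eqP; rewrite eq_complex/= !mul0r subr0 addr0 !eqxx.
  rewrite (_ : (fun N => _) = fun N =>
      (N%:R^-1 * \sum_(1 <= n < N.+1 | squarefree n) complex.Re (phi (iter (a n) f x))) +i*
      (N%:R^-1 * \sum_(1 <= n < N.+1 | squarefree n) complex.Im (phi (iter (a n) f x)))).
    apply: cvg_complex.
    + exact: (squarefree_orbit_average cX cf ub a_add mu_a cRe bx nu_inv).
    + exact: (squarefree_orbit_average cX cf ub a_add mu_a cIm bx nu_inv).
  apply/funext => N; rewrite -complex_average; congr (_ * _).
  by apply: eq_bigr => n _; case: (phi _).
split=> //.
rewrite (_ : (fun N => _) = (fun N : nat => N%:R^-1 *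
    \sum_(1 <= n < N.+1 | squarefree n) phi (iter (a n) f x) : R[i]^o))//.
apply/funext => N; congr (_ * _); rewrite [RHS]big_mkcond.
by apply: eq_bigr => n _; rewrite mobius_sqr; case: ifP => _; rewrite ?mul1r ?mul0r.
Qed.
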